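(* Let $s\ge 1$ be an integer, let $\varepsilon>0$, and let $g:\mathbb{N}\to[0,\infty)$ be a function with $g(\Delta)/\Delta\to 0$ as $\Delta\to\infty$. Then there exists $\Delta_0$ such that the following holds for every integer $\Delta\ge\Delta_0$ for which $(2+\varepsilon)s^2\Delta$ is an integer divisible by $s$. If $G$ is a multipartite graph with a partition $\mathcal{P}=(V_1,V_2,\ldots,V_r)$ such that $|V_i|=(2+\varepsilon)s^2\Delta$ for each $i\in[r]$, $\Delta(G)\le\Delta$ and $\Gamma_{\mathcal{P}}(G)\le g(\Delta)$, then $G$ has a factor of independent transversal blow-ups of size $s$ with respect to $\mathcal{P}$.
   Context: All graphs are finite and simple; $\Delta(G)$ denotes the maximum degree of $G$. A multipartite graph $G$ with partition $\mathcal{P}=(V_1,\ldots,V_r)$ is a graph whose vertex set is the disjoint union of the blocks $V_1,\ldots,V_r$, each of which is an independent set of $G$. The local degree is $\Gamma_{\mathcal{P}}(G)=\max_{v\in V(G)}\max_{i\in[r]}d_G(v,V_i)$, where $d_G(v,V_i)$ is the number of neighbours of $v$ in $V_i$. An independent transversal blow-up of size $s$ with respect to $\mathcal{P}$ is an independent set of $G$ containing exactly $s$ vertices from each block $V_i$. A factor of independent transversal blow-ups of size $s$ is a set of pairwise vertex-disjoint independent transversal blow-ups of size $s$ whose union is $V(G)$. *)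

(* Defs.v *)
From mathcomp Require Import all_boot.
Set Implicit Arguments.
Unset Strict Implicit.
Unset Printing Implicit Defensive.

(* A graph on a finite vertex type V is given by its adjacency relation; a
   family P : 'I_r -> {set V} of vertex sets plays the role of (V_1,..,V_r). *)

Section Graphs.
Variable V : finType.
Implicit Types (e : rel V) (A T : {set V}) (F : {set {set V}}).

Definition simple_graph e : Prop := symmetric e /\ irreflexive e.

Definition independent e A : Prop :=
  forall u v, u \in A -> v \in A -> ~~ e u v.

Definition degree_in e (v : V) A : nat := #|[set w in A | e v w]|.

Definition max_degree e : nat := \max_(v : V) degree_in e v [set: V].

Definition multipartite r e (P : 'I_r -> {set V}) : Prop :=
  [/\ \bigcup_(i < r) P i = [set: V],
      forall i j, i != j -> [disjoint P i & P j]
    & forall i, independent e (P i)].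

Definition local_degree r e (P : 'I_r -> {set V}) : nat :=
  \max_(v : V) \max_(i < r) degree_in e v (P i).

Definition transversal_blowup r e (P : 'I_r -> {set V}) (s : nat) T : Prop :=
  independent e T /\ forall i, #|T :&: P i| = s.

Definition transversal_blowup_factor r e (P : 'I_r -> {set V}) (s : nat) F :
    Prop :=
  [/\ forall T, T \in F -> transversal_blowup e P s T,
      trivIset F
    & cover F = [set: V]].

End Graphs.

(* Main.v *)
(* Splitting every block into [s] parts of size [(2 + eps) * s * Delta] reduces the
   claim to a proper colouring, with as many colours as a part has vertices, that is
   injective on each part.  A partial colouring is extended by the exchange argument of
   Aharoni, Berger and Ziv: to colour [v0] with a colour missing in its part, one needs
   an independent transversal through [v0] avoiding at most [Delta + o(Delta)] vertices
   of each part, so it suffices to have independent transversals for parts of size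
   [(1 + eps) * Delta] and local degree [o(Delta)] (Loh and Sudakov).

   For these, a random sample of constantly many vertices per part already has local
   degree at most 1 and degrees proportional to the part size.  The parts are then
   distributed at random over [T] classes, and transversals of the classes are chosen
   one class at a time: within a class the degrees are tiny compared to the part size,
   and each choice destroys about [Delta / T] vertices of every other part, which over
   all classes leaves a positive proportion intact.  All random choices are handled by
   one counting argument in the style of Rosenfeld: if the number [G(U)] of choices
   without flaw inside the index set [U] satisfies [G(U - c) <= K * G(U)], then the
   correlations of the conditioned measure inflate exponential moments only by replacing
   each expectation by [K] times it, and this in turn gives [G(U) <= K * G(U + b)]. *)
Require Import Defs.
From mathcomp Require Import all_boot all_order all_algebra.
From mathcomp Require Import reals sequences exp ring lra zify.
Set Implicit Arguments.
Unset Strict Implicit.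
Unset Printing Implicit Defensive.
Import Order.TTheory GRing.Theory Num.Theory.
Local Open Scope ring_scope.

(** * Weighted counting of avoiding choices *)

Section Avoidance.
Variables (R : realType) (I A : finType) (L : I -> {set A}) (q : nat).
Hypothesis q_gt0 : (0 < q)%N.
Hypothesis cardL : forall c, #|L c| = q.
Implicit Types (w : {ffun I -> A}) (U : {set I}).

Definition picks w : bool := [forall c, w c \in L c].

Definition repick w (c : I) (y : A) : {ffun I -> A} :=
  [ffun d => if d == c then y else w d].

Lemma repick_eq w c y : repick w c y c = y.
Proof. by rewrite ffunE eqxx. Qed.

Lemma repick_neq w c y d : d != c -> repick w c y d = w d.
Proof. by move=> dc; rewrite ffunE (negPf dc). Qed.

(** Independence of the coordinate [c] from all others, in counting form: exchanging [w c] with a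
    fresh sample [y] is an involution on pairs of a choice and an element of [L c]. *)
Lemma sum_picks_resample (c : I) (h : {ffun I -> A} -> R) (a : A -> R) :
    (forall w y, h (repick w c y) = h w) ->
  \sum_(w | picks w) h w * a (w c) =
  (\sum_(x in L c) a x) / q%:R * \sum_(w | picks w) h w.
Proof.
move=> hc.
have q0 : q%:R != 0 :> R by rewrite pnatr_eq0 -lt0n.
apply: (mulIf q0); rewrite mulrAC divfK // mulrC.
have -> : q%:R * (\sum_(w | picks w) h w * a (w c)) =
    \sum_(p : {ffun I -> A} * A | picks p.1 && (p.2 \in L c))
      h p.1 * a (p.1 c).
  rewrite -(pair_big_dep picks (fun w y => y \in L c) (fun w y => h w * a (w c))) /=.
  rewrite mulr_sumr; apply: eq_bigr => w _.
  by rewrite sumr_const cardL mulr_natl.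
pose f (p : {ffun I -> A} * A) := (repick p.1 c p.2, p.1 c).
have fK : involutive f.
  case=> w y; rewrite /f /= repick_eq; congr (_, _).
  by apply/ffunP => d; rewrite !ffunE; case: eqP => // ->.
rewrite (reindex_inj (inv_inj fK)) /=.
transitivity (\sum_(p : {ffun I -> A} * A | picks p.1 && (p.2 \in L c))
    h p.1 * a p.2).
  apply: eq_big => [[w y]|[w y] _] /=; last by rewrite hc repick_eq.
  apply/andP/andP => -[/forallP wL yL]; split => //.
  - apply/forallP => d; have := wL d; case: (eqVneq d c) => [->|dc] //.
    by rewrite repick_neq.
  - by have := wL c; rewrite repick_eq.
  - apply/forallP => d; case: (eqVneq d c) => [->|dc].
      by rewrite repick_eq.
    by rewrite repick_neq.
rewrite -(pair_big_dep picks (fun w y => y \in L c) (fun w y => h w * a y)) /=.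
by rewrite mulrC mulr_suml; apply: eq_bigr => w _; rewrite mulr_sumr.
Qed.

Variables (J : finType) (bad : J -> {set I} -> {ffun I -> A} -> bool).
Hypothesis bad_local : forall t U w w',
  (forall c, c \in U -> w c = w' c) -> bad t U w -> bad t U w'.
Hypothesis bad_mono : forall t U U' w, U \subset U' -> bad t U w -> bad t U' w.
Hypothesis bad0 : forall t w, ~~ bad t set0 w.

Definition avoids U w : bool := [forall t, ~~ bad t U w].
(** This is [G(U)]. Choices on all of [I] are counted even for small [U], which makes the values for
    different [U] comparable. *)
Definition avoid_weight U : R := \sum_(w | picks w) (avoids U w)%:R.

Lemma avoids_sub U U' w : U \subset U' -> avoids U' w -> avoids U w.
Proof.
move=> UU' /forallP av; apply/forallP => t.
by apply: contra (av t); apply: bad_mono.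
Qed.

Lemma avoids_repick U w c y : avoids (U :\ c) (repick w c y) = avoids (U :\ c) w.
Proof.
apply/eq_forallb => t; congr (~~ _).
by apply/idP/idP; apply: bad_local => d; rewrite !inE => /andP[dc _];
   rewrite repick_neq.
Qed.

Variable (K : R).
Hypothesis K_ge1 : 1 <= K.

(** One factor is expanded at a time. Its constant term keeps the condition on [U]. For its [phi]
    term the condition is weakened to [U :\ c], which frees the coordinate [c] to be averaged;
    returning from [U :\ c] to [U] costs the factor [K]. *)
Lemma avoid_expand (r : seq I) (al : I -> R) (phi : I -> A -> R) U :
    (forall c, 0 <= al c) -> (forall c x, 0 <= phi c x) -> uniq r ->
    (forall U' c, U' \subset U -> avoid_weight (U' :\ c) <= K * avoid_weight U') ->
  \sum_(w | picks w) (avoids U w)%:R * \prod_(c <- r) (al c + phi c (w c)) <=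
  \prod_(c <- r) (al c + K / q%:R * \sum_(x in L c) phi c x) * avoid_weight U.
Proof.
move=> al0 phi0; elim: r U => [|c r IHr] U /=.
  move=> _ _; rewrite big_nil mul1r le_eqVlt; apply/orP; left; apply/eqP.
  by apply: eq_bigr => w _; rewrite big_nil mulr1.
case/andP => cr ur KU.
pose g w : R := \prod_(d <- r) (al d + phi d (w d)).
have g0 w : 0 <= g w by apply: prodr_ge0 => d _; rewrite addr_ge0.
have grep w y : g (repick w c y) = g w.
  apply: eq_big_seq => d dr; rewrite repick_neq //.
  by apply: contraNneq cr => <-.
set P := \prod_(d <- r) (al d + K / q%:R * \sum_(x in L d) phi d x) in IHr *.
have s0 d : 0 <= \sum_(x in L d) phi d x by apply: sumr_ge0.
have K0 : 0 <= K by apply: le_trans K_ge1.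
have P0 : 0 <= P.
  by apply: prodr_ge0 => d _; rewrite addr_ge0 // mulr_ge0 // divr_ge0.
rewrite big_cons -/P.
apply: (@le_trans _ _ (al c * (\sum_(w | picks w) (avoids U w)%:R * g w) +
   \sum_(w | picks w) ((avoids (U :\ c) w)%:R * g w) * phi c (w c))).
  rewrite mulr_sumr -big_split /=; apply: ler_sum => w _.
  rewrite big_cons -/(g w) mulrDl mulrDr mulrCA lerD2l.
  rewrite mulrA mulrAC ler_wpM2r // ler_wpM2r //.
  rewrite ler_nat; case: (boolP (avoids U w)) => // av.
  by rewrite (avoids_sub _ av) // subsetDl.
rewrite sum_picks_resample; last first.
  by move=> w y; rewrite avoids_repick grep.
rewrite mulrDl mulrDl; apply: lerD.
  by rewrite -mulrA ler_wpM2l // IHr.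
apply: (@le_trans _ _ (q%:R^-1 * (\sum_(x in L c) phi c x) * (P * avoid_weight (U :\ c)))).
  rewrite [_ / _]mulrC ler_wpM2l ?mulr_ge0 ?invr_ge0 //; apply: IHr => // U' d sU'.
  by apply: KU; apply: subset_trans sU' _; rewrite subsetDl.
have -> : K / q%:R * (\sum_(x in L c) phi c x) * P * avoid_weight U =
  q%:R^-1 * (\sum_(x in L c) phi c x) * (P * (K * avoid_weight U)) by ring.
by rewrite !ler_wpM2l ?mulr_ge0 ?invr_ge0 // KU.
Qed.

Variables (wt : J -> I -> R) (al : J -> I -> I -> R) (phi : J -> I -> I -> A -> R).
Hypothesis wt_ge0 : forall t b, 0 <= wt t b.
Hypothesis al_ge0 : forall t b c, 0 <= al t b c.
Hypothesis phi_ge0 : forall t b c x, 0 <= phi t b c x.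
Hypothesis bad_new : forall t b U w, picks w -> b \notin U ->
  bad t (b |: U) w -> ~~ bad t U w ->
  1 <= wt t b * \prod_c (al t b c + phi t b c (w c)).
Hypothesis weight_le : forall b,
  \sum_t wt t b * \prod_c (al t b c + K / q%:R * \sum_(x in L c) phi t b c x) <=
  1 - K^-1.

Lemma avoid_weight_ge0 U : 0 <= avoid_weight U.
Proof. by apply: sumr_ge0. Qed.

(** A union bound over the flaws created by adding [b]: by [bad_new] each of them contributes at
    least 1 to the weighted product, whose conditioned mean [avoid_expand] controls. So at most the
    fraction [1 - K^-1] of the choices is lost. *)
Lemma avoid_weight_step U b :
    (forall U' c, U' \subset U -> avoid_weight (U' :\ c) <= K * avoid_weight U') ->
  b \notin U -> avoid_weight U <= K * avoid_weight (b |: U).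
Proof.
move=> KU bU.
have K0 : 0 < K by apply: lt_le_trans K_ge1.
suff: avoid_weight U - avoid_weight (b |: U) <= (1 - K^-1) * avoid_weight U.
  rewrite mulrBl mul1r lerD2l lerN2 mulrC ler_pdivrMr // mulrC //.
rewrite /avoid_weight -sumrB -/(avoid_weight U).
apply: (@le_trans _ _ (\sum_(w | picks w) \sum_t
  (avoids U w)%:R * (wt t b * \prod_c (al t b c + phi t b c (w c))))).
  apply: ler_sum => w pw.
  have t0 t : 0 <= wt t b * \prod_c (al t b c + phi t b c (w c)).
    by rewrite mulr_ge0 // prodr_ge0 // => c _; rewrite addr_ge0.
  case: (boolP (avoids U w)) => av; last first.
    by rewrite sub0r big1 ?oppr_le0 // => t _; rewrite mul0r.
  case: (boolP (avoids (b |: U) w)) => [_|/forallPn[t]].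
    by rewrite subrr sumr_ge0 // => t _; rewrite mul1r.
  rewrite negbK subr0 => bt; rewrite (bigD1 t) //= mul1r ler_wpDr //.
    by apply: sumr_ge0 => u _; rewrite mul1r.
  by apply: bad_new bt _ => //; move/forallP: av.
rewrite exchange_big /=.
apply: le_trans (_ : \sum_t wt t b *
   (\prod_c (al t b c + K / q%:R * \sum_(x in L c) phi t b c x) * avoid_weight U) <= _).
  apply: ler_sum => t _; under eq_bigr do rewrite mulrCA.
  by rewrite -mulr_sumr ler_wpM2l // avoid_expand // index_enum_uniq.
under eq_bigr do rewrite mulrA.
by rewrite -mulr_suml ler_wpM2r ?avoid_weight_ge0.
Qed.

(** Strong induction on the size of [U]: putting [c] back into [U :\ c] needs the ratios only on
    subsets of [U :\ c]. *)
Lemma avoid_weight_decr U c : avoid_weight (U :\ c) <= K * avoid_weight U.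
Proof.
have [n] := ubnP #|U|; elim: n U c => // n IHn U c /ltnSE Un.
have [cU|cU] := boolP (c \in U); last first.
  have -> : U :\ c = U.
    by apply/setP => d; rewrite !inE; case: eqVneq => // ->; rewrite (negPf cU).
  by rewrite ler_peMl // avoid_weight_ge0.
rewrite -[in leRHS](setD1K cU); apply: avoid_weight_step; last by rewrite !inE eqxx.
move=> U' d sU'; apply: IHn; apply: leq_trans Un; rewrite (cardsD1 c U) cU.
by rewrite ltnS subset_leq_card.
Qed.

Theorem weighted_avoidance :
  exists w : {ffun I -> A}, picks w /\ forall t, ~~ bad t setT w.
Proof.
have K0 : 0 < K by apply: lt_le_trans K_ge1.
(* For [set0] every choice counts, and each further index costs at most a factor [K]. *)
have pos U : 0 < avoid_weight U.
  have [n] := ubnP #|U|; elim: n U => // n IHn U /ltnSE Un.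
  have [->|[c cU]] := set_0Vmem U.
    have [w0 pw0] : exists w, picks w.
      have Lc c : exists x, x \in L c by apply/card_gt0P; rewrite cardL.
      exists [ffun c => xchoose (Lc c)]; apply/forallP => c.
      by rewrite ffunE (xchooseP (Lc c)).
    rewrite /avoid_weight (bigD1 w0) //= ltr_wpDr ?sumr_ge0 //.
    by have -> : avoids set0 w0; [apply/forallP => t|rewrite ltr01].
  have := avoid_weight_decr U c; rewrite -(pmulr_rgt0 _ K0); apply: lt_le_trans.
  by apply: IHn; apply: leq_trans Un; rewrite (cardsD1 c U) cU.
have := pos setT; rewrite lt0r => /andP[/eqP nz _].
case: (pickP (fun w => picks w && avoids setT w)) => [w /andP[pw /forallP av]|no].
  by exists w.
case: nz; apply: big1 => w pw; have := no w; rewrite pw /= => ->; by [].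
Qed.

End Avoidance.

(** * Flaws made of forced values and too many hits *)

Lemma sum_indicator_card (R : realType) (A : finType) (B C : {set A}) :
  \sum_(x in B) (x \in C)%:R = #|C :&: B|%:R :> R.
Proof.
rewrite -natr_sum -sum1_card; congr (_%:R).
rewrite big_mkcond [RHS]big_mkcond; apply: eq_bigr => x _.
by rewrite inE andbC; case: (x \in B); case: (x \in C).
Qed.

Section Flaws.
Variables (R : realType) (I A : finType) (L : I -> {set A}) (q : nat).
Hypothesis q_gt0 : (0 < q)%N.
Hypothesis cardL : forall c, #|L c| = q.
Variables (J : finType) (P : pred J) (M : J -> I -> option A).
Variables (H : J -> I -> {set A}) (a : J -> nat) (lam K : R).
Hypothesis lam_ge0 : 0 <= lam.
Hypothesis K_ge1 : 1 <= K.

(** A flaw [t] requires the value [x] wherever [M t c = Some x], and values in [H t c] at [a t] or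
    more of the other indices. With [a t = 0] it is a pure pattern; with nothing forced it is an
    upper tail event. *)
Definition forced (t : J) (w : {ffun I -> A}) (U : {set I}) : bool :=
  [forall c, if M t c is Some x then (c \in U) && (w c == x) else true].

Definition hits (t : J) (w : {ffun I -> A}) (U : {set I}) : {set I} :=
  [set c in U | ~~ M t c & w c \in H t c].

(** The exponential Markov bound on the probability of the flaw, with every expectation inflated by
    [K]. *)
Definition flaw_wt (t : J) : R :=
  (1 + lam) ^- a t *
  \prod_c (if M t c then K / q%:R
           else 1 + K / q%:R * (lam * #|H t c :&: L c|%:R)).

(** A flaw that appears when [b] joins the index set must use [b], either as a forced index or as a
    hit; in the second case a miss at [b] contributes 0 instead of 1, which yields the extra factor
    in the sum. The first hypothesis excludes flaws that occur already inside [set0]. *)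
Theorem flawless_picks :
    (forall t, P t -> (exists c, M t c) \/ (0 < a t)%N) ->
    (forall b, \sum_(t | P t) flaw_wt t *
       (if M t b then 1 else (1 + lam) * (K / q%:R) * #|H t b :&: L b|%:R) <=
       1 - K^-1) ->
  exists w : {ffun I -> A}, picks L w /\
    forall t, P t -> forced t w setT -> (#|hits t w setT| < a t)%N.
Proof.
move=> nontriv wle.
have K0 : 0 <= K by apply: le_trans K_ge1.
have Kq0 : 0 <= K / q%:R by rewrite divr_ge0.
have lam1 : 0 < 1 + lam by rewrite ltr_wpDr.
pose bad t (U : {set I}) w := [&& P t, forced t w U & (a t <= #|hits t w U|)%N].
(* At an unforced [c] other than [b], [al + phi] is [1 + lam] for a hit and 1 for a miss; at an
   unforced [b] it is [1 + lam] or 0. *)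
pose al t b c : R := if M t c then 0 else (c != b)%:R.
pose phi t b c x : R := if M t c is Some y then (x == y)%:R else
  (if c == b then 1 + lam else lam) * (x \in H t c)%:R.
have [||||||||w [pw good]] := @weighted_avoidance R I A L q q_gt0 cardL J bad _ _ _ K
  K_ge1 (fun t b => (P t)%:R * (1 + lam) ^- a t) al phi.
- move=> t U w w' ww' /and3P[Pt /forallP fo hi]; apply/and3P; split=> //.
    apply/forallP => c; have := fo c; case: (M t c) => // x /andP[cU].
    by rewrite -ww' // cU.
  apply: leq_trans hi _; apply: subset_leq_card; apply/subsetP => c.
  by rewrite !inE => /and3P[cU -> ?]; rewrite -ww' ?cU.
- move=> t U U' w /subsetP sU /and3P[Pt /forallP fo hi]; apply/and3P; split=> //.
    by apply/forallP => c; have := fo c; case: (M t c) => // x /andP[/sU -> ->].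
  apply: leq_trans hi _; apply: subset_leq_card; apply/subsetP => c.
  by rewrite !inE => /and3P[/sU -> -> ->].
- move=> t w; apply/negP => /and3P[Pt /forallP fo].
  rewrite (_ : hits t w set0 = set0) ?cards0; last by apply/setP => c; rewrite !inE.
  rewrite leqn0 => a0; case: (nontriv t Pt); last by rewrite lt0n a0.
  by case=> c; have := fo c; case: (M t c) => // x; rewrite inE.
- by move=> t b; rewrite mulr_ge0 // invr_ge0 exprn_ge0 // ltW.
- by move=> t b c; rewrite /al; case: (M t c).
- move=> t b c x; rewrite /phi; case: (M t c) => [y|] //.
  by case: eqP => _; rewrite mulr_ge0 // ltW.
- move=> t b U w pw bU /and3P[Pt /forallP fo hi] nb.
  rewrite Pt mul1r mulrC ler_pdivlMr ?exprn_gt0 // mul1r.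
  (* Hits outside [b |: U] are counted too; they can only enlarge the power of [1 + lam]. *)
  pose h := [set c | ~~ M t c & w c \in H t c].
  have bh : M t b \/ b \in h.
    case Mb: (isSome (M t b)); [by left|right].
    apply: contraNT nb => bh; apply/and3P; split=> //.
      apply/forallP => c; have := fo c; case Mc: (M t c) => [x|] //.
      rewrite !inE; case: eqVneq => [cb|//]; by rewrite cb in Mc; rewrite Mc in Mb.
    apply: leq_trans hi _; apply: subset_leq_card; apply/subsetP => c.
    rewrite !inE => /and3P[/orP[/eqP->|->]]; last by move=> -> ->.
    by move=> Mc wc; rewrite inE Mc wc in bh.
  apply: (@le_trans _ _ ((1 + lam) ^+ #|h|)).
    apply: ler_weXn2l; first by rewrite lerDl.
    apply: leq_trans hi _; apply: subset_leq_card; apply/subsetP => c.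
    by rewrite !inE => /and3P[_ -> ->].
  rewrite -prodr_const big_mkcond /=; apply: ler_prod => c _; apply/andP; split.
    by case: ifP => _ //; apply: ltW.
  rewrite /al /phi inE; have := fo c; case Mc: (M t c) => [x|] /=.
    by case/andP=> _ /eqP->; rewrite eqxx add0r.
  move=> _; case: (eqVneq c b) => [cb|cb] /=.
    case: bh; first by rewrite -cb Mc.
    by rewrite -cb inE Mc /= => ->; rewrite mulr1 add0r.
  by case: (w c \in _); rewrite ?mulr1 ?mulr0 ?addr0.
- move=> b; apply: le_trans (wle b).
  rewrite [X in _ <= X]big_mkcond; apply: ler_sum => t _.
  case: (P t); last by rewrite !mul0r.
  rewrite mul1r /flaw_wt -[X in _ <= X]mulrA ler_wpM2l ?invr_ge0 ?exprn_ge0 ?(ltW lam1) //.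
  pose F c : R := if M t c then K / q%:R
    else 1 + K / q%:R * (lam * #|H t c :&: L c|%:R).
  rewrite -/(\prod_c F c).
  have F0 c : 0 <= F c.
    by rewrite /F; case: (isSome _) => //; rewrite addr_ge0 // mulr_ge0 // mulr_ge0.
  have leF c : M t c \/ c != b ->
     0 <= al t b c + K / q%:R * (\sum_(x in L c) phi t b c x) <= F c.
    rewrite /al /phi /F; case Mc: (M t c) => [y|] /=.
      move=> _; rewrite add0r; apply/andP; split.
        by rewrite mulr_ge0 // sumr_ge0.
      rewrite ler_piMr //; case: (boolP (y \in L c)) => yL.
        rewrite (bigD1 y) //= eqxx big1 ?addr0 // => [x /andP[_ /negPf->]] //.
      by rewrite big1 // => x xL; case: eqP => // xy; rewrite -xy xL in yL.
    case=> // /negPf cb; rewrite cb /=.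
    rewrite -mulr_sumr sum_indicator_card lexx andbT.
    by rewrite addr_ge0 // mulr_ge0 // mulr_ge0.
  case Mb: (isSome (M t b)).
    rewrite mulr1; apply: ler_prod => c _; apply: leF.
    by case: (eqVneq c b) => [->|]; [left|right].
  rewrite (bigD1 b) //= [X in _ <= X * _](bigD1 b) //=.
  have -> : al t b b + K / q%:R * (\sum_(x in L b) phi t b b x) =
      (1 + lam) * (K / q%:R) * #|H t b :&: L b|%:R.
    rewrite /al /phi eqxx; case: (M t b) Mb => // _ /=.
    by rewrite add0r -mulr_sumr sum_indicator_card mulrA [_ * (1 + lam)]mulrC.
  set Z := (1 + lam) * (K / q%:R) * _; have Z0 : 0 <= Z.
    by rewrite /Z mulr_ge0 // mulr_ge0 // ltW.
  rewrite [X in _ <= X]mulrC; apply: ler_wpM2l => //.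
  apply: (@le_trans _ _ (\prod_(c | c != b) F c)).
    by apply: ler_prod => c cb; apply: leF; right.
  (* The right side still contains the factor of the unforced index [b], which is at least 1. *)
  rewrite ler_peMl ?prodr_ge0 // /F Mb lerDl.
  by rewrite mulr_ge0 // mulr_ge0.
exists w; split=> // t Pt fo.
by have := good t; rewrite /bad Pt fo /= -ltnNge.
Qed.

(** By [1 + x <= expR x], only the total number of possible hits matters, not its distribution over
    the indices. *)
Lemma flaw_wt_le t (h : nat) : (\sum_c #|H t c :&: L c| <= h)%N ->
  flaw_wt t <= (1 + lam) ^- a t * (K / q%:R) ^+ #|[set c | isSome (M t c)]| *
               expR (K / q%:R * lam * h%:R).
Proof.
move=> hh; have K0 : 0 <= K by apply: le_trans K_ge1.
have Kq0 : 0 <= K / q%:R by rewrite divr_ge0.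
have lam1 : 0 < 1 + lam by rewrite ltr_wpDr.
rewrite /flaw_wt -mulrA ler_wpM2l ?invr_ge0 ?exprn_ge0 ?(ltW lam1) //.
apply: (@le_trans _ _ (\prod_c ((if isSome (M t c) then K / q%:R else 1) *
    expR (K / q%:R * lam * #|H t c :&: L c|%:R)))).
  apply: ler_prod => c _; case: (isSome (M t c)).
    by rewrite Kq0 ler_peMr // -[X in X <= _]expR0 ler_expR mulr_ge0 // mulr_ge0.
  rewrite mul1r mulrA addr_ge0 ?expR_ge1Dx //.
  by rewrite mulr_ge0 // mulr_ge0.
rewrite big_split /= -big_mkcond prodr_const -expR_sum -mulr_sumr cardsE.
rewrite ler_wpM2l ?exprn_ge0 // ler_expR ler_wpM2l ?(mulr_ge0 Kq0 lam_ge0) //.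
by rewrite -natr_sum ler_nat.
Qed.

End Flaws.

(** * Balanced distribution of the blocks over classes *)

Lemma balanced_classes (R : realType) (V I : finType) (T a1 a2 d : nat)
    (rho : V -> I -> bool) (lam K : R) :
    (0 < T)%N -> (0 < a2)%N -> 0 <= lam -> 1 <= K ->
    (forall v, #|[set j | rho v j]| <= a1)%N ->
    (forall j, #|[set v | rho v j]| <= d)%N ->
    (1 + lam) ^- a2 * expR (K / T%:R * lam * a1%:R) * ((1 + lam) * K * d%:R) <=
      1 - K^-1 ->
  exists cl : I -> 'I_T, forall v t, (#|[set j | rho v j & cl j == t]| < a2)%N.
Proof.
move=> T0 a20 lam0 K1 deg1 deg2 small.
have K0 : 0 <= K by apply: le_trans K1.
have lam1 : 0 < 1 + lam by rewrite ltr_wpDr.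
pose L (c : I) := [set: 'I_T].
(* The flaw [(v, t)] says that at least [a2] of the blocks related to [v] land in class [t]. Nothing
   is forced, and the mean number of hits is at most [a1 / T]. *)
pose M (t : V * 'I_T) (c : I) : option 'I_T := None.
pose H (t : V * 'I_T) (c : I) := if rho t.1 c then [set t.2] else set0.
have HL t c : #|H t c :&: L c| = rho t.1 c.
  by rewrite setIT /H; case: (rho _ _); rewrite ?cards1 ?cards0.
have [|||w [_ good]] := @flawless_picks R I 'I_T L T T0 _ _ predT M H (fun=> a2)
  lam K lam0 K1.
- by move=> c; rewrite cardsT card_ord.
- by move=> t _; right.
- move=> b; apply: le_trans small.
  apply: (@le_trans _ _ (\sum_(t : V * 'I_T)
     ((1 + lam) ^- a2 * expR (K / T%:R * lam * a1%:R) * ((1 + lam) * (K / T%:R))) *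
     (rho t.1 b)%:R)).
    apply: ler_sum => t _; rewrite /= HL mulrA ler_wpM2r // ler_wpM2r //.
      by rewrite mulr_ge0 ?divr_ge0 // ltW.
    have := @flaw_wt_le R I _ L T _ M H (fun=> a2) lam K lam0 K1 t a1.
    have -> : [set c | isSome (M t c)] = set0 by apply/setP => c; rewrite !inE.
    rewrite cards0 expr0 mulr1; apply.
    apply: leq_trans (deg1 t.1); rewrite -sum1_card [leqRHS]big_mkcond /=.
    by apply: leq_sum => c _; rewrite HL inE; case: (rho _ _).
  rewrite -mulr_sumr -mulrA.
  rewrite ler_wpM2l ?mulr_ge0 ?invr_ge0 ?exprn_ge0 ?expR_ge0 ?(ltW lam1) //.
  (* The index [b] can be a hit in at most [d * T] flaws, and this [T] cancels the chance [1 / T] of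
     a hit. *)
  rewrite (_ : (1 + lam) * K * d%:R = (1 + lam) * (K / T%:R) * (d%:R * T%:R)).
    2: by field; rewrite pnatr_eq0 -lt0n.
  rewrite ler_wpM2l ?(mulr_ge0 (ltW lam1) (divr_ge0 K0 (ler0n _ _))) //.
  rewrite -natrM -natr_sum ler_nat.
  rewrite -(pair_big xpredT xpredT (fun v t => nat_of_bool (rho v b))) /=.
  under eq_bigr do rewrite sum_nat_const card_ord mulnC.
  rewrite -big_distrl /= leq_mul2r; apply/orP; right.
  apply: leq_trans (deg2 b); rewrite -sum1_card [leqRHS]big_mkcond /=.
  by apply: leq_sum => v _; rewrite inE; case: (rho v b).
exists w => v t; have := good (v, t) isT _.
have -> : hits M H (v, t) w setT = [set j | rho v j & w j == t].
  apply/setP => c; rewrite !inE /H /=.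
  by case: (rho v c); rewrite ?inE //= andbF.
by apply; apply/forallP.
Qed.

(** * Choosing a transversal of one class of blocks *)

Lemma card_setI_sum (T : finType) (A : {set T}) (P : pred T) :
  #|[set x in A | P x]| = (\sum_(x in A) P x)%N.
Proof.
rewrite -sum1_card [LHS]big_mkcond [RHS]big_mkcond /=.
by apply: eq_bigr => x _; rewrite inE; case: (x \in A) => //; case: (P x).
Qed.

Lemma card_exists_le (T U : finType) (A : {set T}) (B : {set U}) (r : T -> U -> bool) :
  (#|[set x in A | [exists y in B, r x y]]| <= \sum_(y in B) #|[set x in A | r x y]|)%N.
Proof.
rewrite card_setI_sum; under [leqRHS]eq_bigr do rewrite card_setI_sum.
rewrite exchange_big /=; apply: leq_sum => x _.
by case: existsP => // -[y /andP[yB rxy]]; rewrite (bigD1 y) //= rxy.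
Qed.

Lemma sum_card_fibers (T I : finType) (A : {set T}) (f : T -> I) :
  (\sum_i #|[set x in A | f x == i]| = #|A|)%N.
Proof.
rewrite -[RHS]sum1_card (partition_big f predT) //=.
apply: eq_bigr => i _; rewrite -sum1_card; apply: eq_bigl => x.
by rewrite inE.
Qed.

Section Round.
Variables (R : realType) (V I : finType) (pt : V -> I) (e : rel V) (S : {set V}).
Hypothesis e_sym : symmetric e.
Variables (m a1 a2 a3 : nat) (cls : pred I) (lam K : R).
Hypotheses (m_gt0 : (0 < m)%N) (a3_gt0 : (0 < a3)%N).
Hypothesis blocks : forall i, #|[set x in S | pt x == i]| = m.
Hypothesis degree : forall v, (#|[set u in S | e v u]| <= a1)%N.
Hypothesis degree_cls :
  forall v, (#|[set u in S | e v u & cls (pt u)]| <= a2)%N.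
Hypothesis local : forall v i, (#|[set u in S | e v u & pt u == i]| <= 1)%N.
Hypotheses (lam_ge0 : 0 <= lam) (K_ge1 : 1 <= K).
Hypothesis small : 2 * K ^+ 2 * a2%:R / m%:R +
  (1 + lam) ^- a3 * expR (K * lam * a2%:R) * ((1 + lam) * K * a1%:R) <= 1 - K^-1.

Let L (c : I) := [set x in S | pt x == c].
Let clash (p : V * V) : bool :=
  [&& p.1 \in S, p.2 \in S, e p.1 p.2, cls (pt p.1), cls (pt p.2)
    & pt p.1 != pt p.2].
(** The flaw [inl (u, w)] forces both ends of an edge between blocks of the class; the flaw [inr i]
    says that [a3] or more blocks of the class choose a vertex with a neighbour in block [i]. *)
Let P (t : V * V + I) := if t is inl p then clash p else true.
Let M (t : V * V + I) (c : I) : option V :=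
  if t is inl p then
    if c == pt p.1 then Some p.1 else if c == pt p.2 then Some p.2 else None
  else None.
Let near (i : I) : {set V} := [set u | [exists w in L i, e u w]].
Let H (t : V * V + I) (c : I) : {set V} :=
  if t is inr i then if cls c then near i else set0 else set0.
Let a (t : V * V + I) : nat := if t is inr _ then a3 else 0.

Let clash_count b : (\sum_(p | clash p) (pt p.1 == b) <= m * a2)%N.
Proof.
rewrite big_mkcond -(pair_big xpredT xpredT
  (fun u w => if clash (u, w) then nat_of_bool (pt u == b) else 0%N)) /=.
rewrite -(blocks b) -sum_nat_const [leqRHS]big_mkcond /=.
apply: leq_sum => u _; rewrite inE /clash /=.
case: (u \in S) => /=; last by rewrite big1.
case: (pt u == b) => /=; last by rewrite big1 // => w _; case: ifP.
apply: leq_trans (degree_cls u); rewrite -sum1_card [leqRHS]big_mkcond /=.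
by apply: leq_sum => w _; rewrite inE; case: (w \in S); case: (e u w);
  case: (cls (pt u)); case: (cls (pt w)) => //=; case: (_ != _).
Qed.

Let clash_count' b : (\sum_(p | clash p) (pt p.2 == b) <= m * a2)%N.
Proof.
pose swap (p : V * V) := (p.2, p.1).
rewrite (reindex_inj (h := swap)) /=; last by move=> [x y] [z t] [-> ->].
apply: leq_trans (clash_count b); rewrite leq_eqVlt; apply/orP; left; apply/eqP.
apply: eq_bigl => -[u w]; rewrite /clash /= [e w u]e_sym [pt w == _]eq_sym.
by case: (u \in S); case: (w \in S) => //=; case: (e u w); case: (cls (pt u));
  case: (cls (pt w)).
Qed.

(** Divided by [m], this bounds the mean number of hits of the flaw [inr i] by [a2]. *)
Let near_sum i : (\sum_c #|H (inr i) c :&: L c| <= m * a2)%N.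
Proof.
apply: leq_trans (_ : \sum_c #|[set u in [set u in S | cls (pt u) &
    [exists w in L i, e u w]] | pt u == c]| <= _)%N.
  apply: leq_sum => c _; rewrite /H; apply: subset_leq_card; apply/subsetP => u.
  rewrite !inE; case: (boolP (cls c)) => cc; last by rewrite inE.
  by rewrite !inE => /and3P[-> -> /eqP->]; rewrite cc eqxx.
rewrite sum_card_fibers -(blocks i) -sum_nat_const.
apply: leq_trans (_ : \sum_(w in L i) #|[set u in [set u in S | cls (pt u)] | e u w]|
   <= _)%N.
  apply: leq_trans (card_exists_le _ _ _); apply: subset_leq_card.
  by apply/subsetP => u; rewrite !inE => /and3P[-> -> ->].
apply: leq_sum => w _; apply: leq_trans (degree_cls w); apply: subset_leq_card.
by apply/subsetP => u; rewrite !inE e_sym => /andP[/andP[-> ->] ->].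
Qed.

(** The same incidences seen from block [b]: each of its [m] vertices has neighbours in at most [a1]
    blocks. *)
Let near_count b : (\sum_i #|H (inr i) b :&: L b| <= m * a1)%N.
Proof.
apply: leq_trans (_ : \sum_i \sum_(u in L b) [exists w in L i, e u w] <= _)%N.
  apply: leq_sum => i _; rewrite -card_setI_sum; apply: subset_leq_card.
  apply/subsetP => u; rewrite !inE /H; case: (cls b); last by rewrite inE.
  by rewrite !inE => /and3P[-> -> ->].
rewrite exchange_big /= -(blocks b) -sum_nat_const; apply: leq_sum => u _.
apply: leq_trans (degree u); rewrite -[leqRHS](sum_card_fibers _ pt).
apply: leq_sum => i _; case: existsP => // -[w /andP[]]; rewrite inE => /andP[wS wi] uw.
by rewrite lt0n cards_eq0; apply/set0Pn; exists w; rewrite !inE wS uw.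
Qed.

Lemma class_transversal :
  exists X : {ffun I -> V}, [/\ forall i, X i \in S /\ pt (X i) = i,
    forall i j, i != j -> cls i -> cls j -> ~~ e (X i) (X j)
  & forall i, (#|[set w in S | (pt w == i) && [exists j, cls j && e (X j) w]]| < a3)%N].
Proof.
have K0 : 0 <= K by apply: le_trans K_ge1.
have Km0 : 0 <= K / m%:R by rewrite divr_ge0.
have lam1 : 0 < 1 + lam by rewrite ltr_wpDr.
have m0 : m%:R != 0 :> R by rewrite pnatr_eq0 -lt0n.
have [||X [pX good]] := @flawless_picks R I V L m m_gt0 blocks _ P M H a
  lam K lam_ge0 K_ge1.
- move=> [p|i] _; last by right.
  by left; exists (pt p.1); rewrite /= eqxx.
- move=> b; apply: le_trans small; rewrite big_sumType /=; apply: lerD.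
    apply: (@le_trans _ _ (\sum_(p | clash p) (K / m%:R) ^+ 2 *
       ((pt p.1 == b) + (pt p.2 == b))%N%:R)).
      apply: ler_sum => p cp.
      have := @flaw_wt_le R I _ L m _ M H a lam K lam_ge0 K_ge1 (inl p) 0.
      rewrite expr0 invr1 mul1r mulr0 expR0 mulr1.
      have -> : [set c | isSome (M (inl p) c)] = [set pt p.1; pt p.2].
        by apply/setP => c; rewrite !inE /=; case: eqP => //; case: eqP.
      rewrite cards2; case/and5P: (cp) => _ _ _ _ /andP[_ ->].
      rewrite big1 => [/(_ isT) le2|c _]; last by rewrite set0I cards0.
      rewrite set0I cards0 mulr0.
      case: eqP => [->|_] /=; last case: eqP => [->|_] /=.
      + rewrite eqxx mulr1; apply: le_trans le2 _.
        by rewrite ler_peMr ?exprn_ge0 // ler1n.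
      + rewrite eqxx mulr1; apply: le_trans le2 _.
        by rewrite ler_peMr ?exprn_ge0 // ler1n addn1.
      + by rewrite mulr0 mulr_ge0 ?exprn_ge0.
    (* Either end of a clash may lie in [b], with at most [m * a2] clashes each; times [(K / m) ^ 2]
       this is [2 * K ^ 2 * a2 / m]. *)
    rewrite -mulr_sumr -natr_sum big_split /=.
    apply: (@le_trans _ _ ((K / m%:R) ^+ 2 * (m * a2 + m * a2)%N%:R)).
      by rewrite ler_wpM2l ?exprn_ge0 // ler_nat leq_add.
    rewrite natrD natrM le_eqVlt; apply/orP; left; apply/eqP.
    by field.
  apply: (@le_trans _ _ (\sum_i
     ((1 + lam) ^- a3 * expR (K * lam * a2%:R)) * ((1 + lam) * (K / m%:R)) *
       #|H (inr i) b :&: L b|%:R)).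
    apply: ler_sum => i _; rewrite mulrA ler_wpM2r // ler_wpM2r ?(mulr_ge0 (ltW lam1) Km0) //.
    have := @flaw_wt_le R I _ L m _ M H a lam K lam_ge0 K_ge1 (inr i) _ (near_sum i).
    have -> : [set c | isSome (M (inr i) c)] = set0 by apply/setP => c; rewrite !inE.
    rewrite cards0 expr0 mulr1.
    rewrite (_ : K / m%:R * lam * (m * a2)%N%:R = K * lam * a2%:R) //.
    by rewrite natrM; field.
  rewrite -mulr_sumr -mulrA.
  rewrite ler_wpM2l ?(mulr_ge0 _ (expR_ge0 _)) ?invr_ge0 ?exprn_ge0 ?(ltW lam1) //.
  rewrite (_ : (1 + lam) * K * a1%:R = (1 + lam) * (K / m%:R) * (m * a1)%N%:R).
    by rewrite ler_wpM2l ?(mulr_ge0 (ltW lam1) Km0) // -natr_sum ler_nat near_count.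
  by rewrite natrM; field.
exists X.
have XL i : X i \in S /\ pt (X i) = i.
  by have /forallP/(_ i) := pX; rewrite inE => /andP[-> /eqP->].
split=> // [i j ij ci cj|i].
  apply/negP => eij.
  have cl : P (inl (X i, X j)).
    by rewrite /= /clash /= !(proj1 (XL _)) !(proj2 (XL _)) eij ci cj ij.
  suff /(good _ cl) : forced M (inl (X i, X j)) X setT by rewrite ltn0.
  apply/forallP => c; rewrite /= !(proj2 (XL _)).
  by case: eqP => [->|_]; [|case: eqP => [->|//]]; rewrite inE eqxx.
(* By local degree at most 1, each hit destroys at most one vertex of block [i]. *)
apply: leq_ltn_trans (good (inr i) isT _); last by apply/forallP.
apply: leq_trans (_ : \sum_(j in hits M H (inr i) X setT) 1 <= _)%N;
  last by rewrite sum1_card.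
apply: leq_trans (_ : #|[set w in L i | [exists j in hits M H (inr i) X setT,
   e (X j) w]]| <= _)%N.
  apply: subset_leq_card; apply/subsetP => w; rewrite !inE.
  case/and3P => wS wi; rewrite wS wi => /existsP[j /andP[cj ejw]]; apply/existsP; exists j.
  rewrite ejw andbT !inE /= cj /= inE; apply/existsP; exists w.
  by rewrite inE ejw wS wi.
apply: leq_trans (card_exists_le _ _ _) _; apply: leq_sum => j _.
apply: leq_trans (local (X j) i); apply: subset_leq_card; apply/subsetP => w.
by rewrite !inE => /andP[/andP[-> ->] ->].
Qed.

End Round.

(** * Cutting blocks into bins of equal size *)

Lemma card_index_lt (T : finType) (A : {set T}) (k : nat) : (k <= #|A|)%N ->
  #|[set x in A | (index x (enum A) < k)%N]| = k.
Proof.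
move=> kA; rewrite -[RHS](size_takel (s := enum A)) -?cardE //.
rewrite -(card_uniqP (take_uniq k (enum_uniq A))); apply: eq_card => x.
rewrite inE; case: (boolP (x \in A)) => xA /=; first by apply/esym/in_take; rewrite mem_enum.
by apply/esym/negbTE; apply: contra xA => /mem_take; rewrite mem_enum.
Qed.

(** Each block is enumerated and cut into runs of [q] consecutive vertices. Indices from [n.+1 * q]
    on are discarded, so [inord] is exact on [S]. *)
Lemma equal_bins (V I : finType) (pt : V -> I) (G : {set V}) (n q : nat) :
    (forall i, n.+1 * q <= #|[set x in G | pt x == i]|)%N ->
  exists (S : {set V}) (bin : V -> 'I_n.+1), S \subset G /\
    forall i k, #|[set x in S | (pt x == i) && (bin x == k)]| = q.
Proof.
move=> big; pose B i := [set x in G | pt x == i].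
pose idx x := index x (enum (B (pt x))).
exists [set x in G | (idx x < n.+1 * q)%N], (fun x => inord (idx x %/ q)).
split; first by apply/subsetP => x; rewrite inE => /andP[].
move=> i k; have [->|q0] := posnP q.
  by apply/eqP; rewrite cards_eq0; apply/eqP/setP => x; rewrite !inE muln0 ltn0 andbF.
have kn : (k.+1 * q <= n.+1 * q)%N by rewrite leq_mul2r ltn_ord orbT.
have -> : [set x in [set x in G | (idx x < n.+1 * q)%N] |
    (pt x == i) && (inord (idx x %/ q) == k)] =
    [set x in B i | (index x (enum (B i)) < k.+1 * q)%N] :\:
    [set x in B i | (index x (enum (B i)) < k * q)%N].
  apply/setP => x; rewrite !inE /idx; case: (x \in G) => //=.
  case: (eqVneq (pt x) i) => [->|_] /=; last by rewrite !andbF.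
  set j := index _ _; rewrite -leqNgt.
  have jk : (j %/ q == k :> nat)%N = (k * q <= j < k.+1 * q)%N.
    by rewrite -(ltn_divLR _ _ q0) -(leq_divRL _ _ q0) ltnS eqn_leq andbC.
  case: ltnP => jn /=.
    rewrite -jk -val_eqE /= inordK //; by rewrite ltn_divLR.
  by rewrite ltnNge (leq_trans kn jn) andbF.
rewrite cardsD (_ : _ :&: _ = [set x in B i | (index x (enum (B i)) < k * q)%N]).
  rewrite !card_index_lt ?mulSn ?addnK //; apply: leq_trans (big i) => //.
  by apply: leq_trans kn; rewrite mulSn leq_addl.
apply/setP => x; rewrite !inE; case: (x \in G) => //=; case: (pt x == i) => //=.
rewrite andbC; case: (ltnP _ (k * q)) => //= lt.
by apply: leq_trans lt _; rewrite mulSn leq_addl.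
Qed.

Lemma trim_blocks (V I : finType) (pt : V -> I) (G : {set V}) (q : nat) :
    (forall i, q <= #|[set x in G | pt x == i]|)%N ->
  exists S : {set V}, S \subset G /\ forall i, #|[set x in S | pt x == i]| = q.
Proof.
move=> big; have [|S [bin [SG card]]] := @equal_bins V I pt G 0 q.
  by move=> i; rewrite mul1n.
exists S; split=> // i; rewrite -(card i ord0); apply: eq_card => x.
by rewrite !inE (ord1 (bin x)) eqxx andbT.
Qed.

(** * Transversals of blocks with local degree 1, one class at a time *)

Section Sparse.
Variables (R : realType) (V I : finType) (pt : V -> I) (e : rel V) (S : {set V}).
Hypothesis e_sym : symmetric e.
Hypothesis e_supp : forall u v, e u v -> u \in S.
Variables (n m a1 a2 a3 T : nat) (lam K : R).
Hypotheses (m_gt0 : (0 < m)%N) (a2_gt0 : (0 < a2)%N) (a3_gt0 : (0 < a3)%N).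
Hypothesis T_gt0 : (0 < T)%N.
Hypothesis n_ge : (T * a3 + m <= n)%N.
Hypothesis blocks : forall i, #|[set x in S | pt x == i]| = n.
Hypothesis degree : forall v, (#|[set u in S | e v u]| <= a1)%N.
Hypothesis local : forall v i, (#|[set u in S | e v u & pt u == i]| <= 1)%N.
Hypotheses (lam_ge0 : 0 <= lam) (K_ge1 : 1 <= K).
Hypothesis small_cls :
  (1 + lam) ^- a2 * expR (K / T%:R * lam * a1%:R) * ((1 + lam) * K * (n * a1)%N%:R) <=
  1 - K^-1.
Hypothesis small_round : 2 * K ^+ 2 * a2%:R / m%:R +
  (1 + lam) ^- a3 * expR (K * lam * a2%:R) * ((1 + lam) * K * a1%:R) <= 1 - K^-1.

Let adj (v : V) (j : I) : bool := [exists u in [set x in S | pt x == j], e v u].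

Let adj_deg v : (#|[set j | adj v j]| <= a1)%N.
Proof.
apply: leq_trans (degree v); rewrite -[leqRHS](sum_card_fibers _ pt).
rewrite -sum1_card [leqLHS]big_mkcond; apply: leq_sum => j _; rewrite inE /adj.
case: existsP => // -[u /andP[]]; rewrite inE => /andP[uS uj] vu.
by rewrite lt0n cards_eq0; apply/set0Pn; exists u; rewrite !inE uS vu.
Qed.

(** [e_supp] confines [v] to [S], so that [v] is among the at most [a1] neighbours in [S] of one of
    the [n] vertices of block [j]. *)
Let adj_codeg j : (#|[set v | adj v j]| <= n * a1)%N.
Proof.
apply: leq_trans (_ : #|[set v in S | adj v j]| <= _)%N.
  apply: subset_leq_card; apply/subsetP => v; rewrite !inE => av.
  by rewrite av andbT; case/existsP: av => u /andP[_ /e_supp].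
apply: leq_trans (card_exists_le _ _ _) _; rewrite -(blocks j) -sum_nat_const.
apply: leq_sum => u _; apply: leq_trans (degree u); apply: subset_leq_card.
by apply/subsetP => v; rewrite !inE e_sym.
Qed.

Lemma sparse_transversal :
  exists X : {ffun I -> V}, (forall i, X i \in S /\ pt (X i) = i) /\
    forall i j, i != j -> ~~ e (X i) (X j).
Proof.
have K0 : 0 <= K by apply: le_trans K_ge1.
have lam1 : 0 < 1 + lam by rewrite ltr_wpDr.
have [cl clP] := balanced_classes T_gt0 a2_gt0 lam_ge0 K_ge1 adj_deg adj_codeg small_cls.
(* After [t] classes, [X] is final on the classes below [t] and arbitrary elsewhere, and its final
   vertices have no neighbours in [S'] inside the blocks still to come. All blocks are kept at one
   common size, as [class_transversal] requires. *)
suff inv t : (t <= T)%N -> exists (S' : {set V}) (X : {ffun I -> V}),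
   [/\ S' \subset S, forall i, #|[set x in S' | pt x == i]| = (n - t * a3)%N,
     forall i, X i \in S /\ pt (X i) = i,
     forall i j, i != j -> (cl i < t)%N -> (cl j < t)%N -> ~~ e (X i) (X j) &
     forall i w, (cl i < t)%N -> w \in S' -> (t <= cl (pt w))%N -> ~~ e (X i) w].
  have [S' [X [_ _ XS Xe _]]] := inv T (leqnn T).
  by exists X; split=> // i j ij; apply: Xe.
elim: t => [_|t IHt tT].
  have Sx i : exists x, x \in [set x in S | pt x == i].
    by apply/card_gt0P; rewrite blocks; apply: leq_trans n_ge; rewrite addn_gt0 m_gt0 orbT.
  exists S, [ffun i => xchoose (Sx i)]; split=> // [i|i].
    by rewrite blocks mul0n subn0.
  by rewrite ffunE; have := xchooseP (Sx i); rewrite inE => /andP[-> /eqP].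
have [S' [X [S'S S'card XS Xe XS']]] := IHt (ltnW tT).
have tn : (t.+1 * a3 + m <= n)%N.
  by apply: leq_trans n_ge; rewrite leq_add2r leq_mul2r tT orbT.
have mt : (m <= n - t * a3)%N by rewrite leq_subRL; lia.
have sub_deg (A B : {set V}) (Q : pred V) (k : nat) : A \subset B ->
    (#|[set u in B | Q u]| <= k -> #|[set u in A | Q u]| <= k)%N.
  move=> /subsetP AB; apply: leq_trans; apply: subset_leq_card.
  by apply/subsetP => u; rewrite !inE => /andP[/AB -> ->].
have [|||||Y [YS Ye Yhit]] := @class_transversal R V I pt e S' e_sym (n - t * a3) a1 a2 a3
   (fun i => cl i == t :> nat) lam K _ a3_gt0 S'card _ _ _ lam_ge0 K_ge1.
- by apply: leq_trans mt.
- by move=> v; apply: sub_deg (degree v).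
- move=> v; apply: sub_deg S'S _.
  pose t' := Ordinal tT; apply: leq_trans (ltnW (clP v t')).
  (* By local degree at most 1, neighbours in the class are no more numerous than adjacent blocks of
     the class, which [clP] bounds. *)
  rewrite -[leqLHS](sum_card_fibers _ pt) -sum1_card [leqRHS]big_mkcond /=.
  apply: leq_sum => j _; rewrite inE.
  have [->|[u]] := set_0Vmem [set x in [set u in S | e v u & cl (pt u) == t :> nat]
     | pt x == j]; first by rewrite cards0.
  rewrite !inE => /andP[/and3P[uS vu cu] /eqP uj].
  have -> : adj v j && (cl j == t').
    rewrite -val_eqE /= -uj cu andbT; apply/existsP; exists u.
    by rewrite inE uS eqxx.
  apply: leq_trans (local v j); apply: subset_leq_card; apply/subsetP => w.
  by rewrite !inE => /andP[/and3P[-> -> _] ->].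
- by move=> v i; apply: sub_deg (local v i).
- apply: le_trans small_round; rewrite lerD2r; apply: ler_wpM2l.
    by rewrite mulr_ge0 // mulr_ge0 // exprn_ge0.
  by rewrite lef_pV2 ?posrE ?ltr0n ?ler_nat //; apply: leq_trans mt.
(* The vertices surviving this round: every block loses fewer than [a3], and is then trimmed to the
   prescribed size. *)
pose G := [set w in S' | ~~ [exists j, (cl j == t :> nat) && e (Y j) w]].
have [i|S'' [S''G S''card]] := @trim_blocks V I pt G (n - t.+1 * a3).
  have := S'card i; have := Yhit i.
  rewrite -(cardsID [set w | [exists j, (cl j == t :> nat) && e (Y j) w]]
    [set x in S' | pt x == i]).
  have -> : [set x in S' | pt x == i] :\:
     [set w | [exists j, (cl j == t :> nat) && e (Y j) w]] = [set x in G | pt x == i].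
    by apply/setP => w; rewrite !inE andbA; congr (_ && _); rewrite andbC.
  have -> : [set x in S' | pt x == i] :&:
     [set w | [exists j, (cl j == t :> nat) && e (Y j) w]] =
     [set w in S' | (pt w == i) && [exists j, (cl j == t :> nat) && e (Y j) w]].
    by apply/setP => w; rewrite !inE andbA.
  set A := #|_|; set B := #|_|; rewrite mulSn; lia.
exists S'', [ffun i => if cl i == t :> nat then Y i else X i].
have S''P w : w \in S'' -> w \in S' /\
    forall j, cl j == t :> nat -> ~~ e (Y j) w.
  move/(subsetP S''G); rewrite inE => /andP[-> /existsPn no]; split=> // j cj.
  by have := no j; rewrite cj.
have YS' i : Y i \in S' by case: (YS i).
split=> //.
- by apply/subsetP => w /S''P[/(subsetP S'S)].
- move=> i; rewrite ffunE; case: ifP => // _.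
  by have [/(subsetP S'S)] := YS i.
- move=> i j ij; rewrite !ltnS !ffunE (leq_eqVlt (cl i)) (leq_eqVlt (cl j)).
  case: eqP => /= [ci _|_ ci]; case: eqP => /= [cj _|_ cj].
  + by apply: Ye => //; apply/eqP.
  + rewrite e_sym; apply: XS' => //; by have [_ ->] := YS i; rewrite ci.
  + apply: XS' => //; by have [_ ->] := YS j; rewrite cj.
  + exact: Xe.
- move=> i w; rewrite ltnS ffunE leq_eqVlt => ci /S''P[wS' wY] cw.
  case: eqP ci => /= [ci _|_ ci]; first by apply: wY; apply/eqP.
  by apply: XS' => //; apply: ltnW.
Qed.
End Sparse.

(** * Sampling blocks of constant size *)

Section Sparsify.
Variables (R : realType) (V I : finType) (pt : V -> I) (e : rel V) (S0 : {set V}).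
Hypothesis e_sym : symmetric e.
Hypothesis e_blocks : forall u v, e u v -> pt u != pt v.
Variables (n q D g a1 : nat) (bin : V -> 'I_n.+1) (lam K : R).
Hypothesis q_gt0 : (0 < q)%N.
Hypothesis bins :
  forall i k, #|[set x in S0 | (pt x == i) && (bin x == k)]| = q.
Hypothesis degree : forall v, (#|[set u in S0 | e v u]| <= D)%N.
Hypothesis local : forall v i, (#|[set u in S0 | e v u & pt u == i]| <= g)%N.
Hypotheses (lam_ge0 : 0 <= lam) (K_ge1 : 1 <= K).
Hypothesis small :
  (1 + lam) ^- a1 * expR (K * lam * (D%:R / q%:R)) *
    (K * (1 + (1 + lam) * K * (D%:R / q%:R))) +
  3 * K ^+ 3 * (D%:R / q%:R) * (g%:R / q%:R) <= 1 - K^-1.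

Let part (x : V) : I * 'I_n.+1 := (pt x, bin x).
Let L (c : I * 'I_n.+1) : {set V} := [set x in S0 | part x == c].
Let tight (t : V * (V * V)) : bool :=
  [&& t.1 \in S0, t.2.1 \in S0, t.2.2 \in S0, e t.1 t.2.1, e t.1 t.2.2,
      pt t.2.1 == pt t.2.2 & bin t.2.1 != bin t.2.2].
(** One vertex is sampled from each part [(i, k)]. The flaw [inl v] says that [v] is sampled with at
    least [a1] neighbours; [inr (v, (u, u'))] that it is sampled with two neighbours in one block.
    These lie in different bins, since a part yields a single vertex. *)
Let P (t : V + V * (V * V)) := match t with inl v => v \in S0 | inr p => tight p end.
Let M (t : V + V * (V * V)) (c : I * 'I_n.+1) : option V :=
  match t with
  | inl v => if c == part v then Some v else None
  | inr p => if c == part p.1 then Some p.1 else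
             if c == part p.2.1 then Some p.2.1 else
             if c == part p.2.2 then Some p.2.2 else None
  end.
Let H (t : V + V * (V * V)) (c : I * 'I_n.+1) : {set V} :=
  if t is inl v then [set u | e v u] else set0.
Let a (t : V + V * (V * V)) : nat := if t is inl _ then a1 else 0.

Let cardL c : #|L c| = q.
Proof.
by case: c => i k; rewrite -(bins i k); apply: eq_card => x; rewrite /L !inE /part xpair_eqE.
Qed.

Let sum_part b : (\sum_(v in S0) (part v == b) = q)%N.
Proof. by rewrite -card_setI_sum -(cardL b). Qed.

Let sum_nbr b : (\sum_(v in S0) #|[set u | e v u] :&: L b| <= q * D)%N.
Proof.
rewrite -(cardL b) -sum_nat_const.
apply: leq_trans (_ : \sum_(v in S0) \sum_(u in L b) e v u <= _)%N.
  apply: leq_sum => v _; rewrite -card_setI_sum; apply: subset_leq_card.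
  by apply/subsetP => u; rewrite !inE => /and3P[-> -> ->].
rewrite exchange_big /=; apply: leq_sum => u _; apply: leq_trans (degree u).
rewrite card_setI_sum; apply: leq_sum => v _; by rewrite e_sym.
Qed.

(** Shared by the three roles that a vertex of part [b] can play in a tight triple: [x] is that
    vertex, [y] one of its at most [D] neighbours, and [z] one of at most [g] vertices once [x] and
    [y] are known. *)
Let count3 b (A : V -> V -> {set V}) (F : V -> V -> V -> nat) :
    (forall x y, #|A x y| <= g)%N ->
    (forall x y z, F x y z <= [&& x \in L b, y \in S0, e x y & z \in A x y])%N ->
  (\sum_x \sum_y \sum_z F x y z <= q * (D * g))%N.
Proof.
move=> Ag leF; rewrite -(cardL b) -sum_nat_const [leqRHS]big_mkcond /=.
apply: leq_sum => x _; case: ifP => xL; last first.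
  rewrite big1 // => y _; rewrite big1 // => z _; apply/eqP; rewrite -leqn0.
  by apply: leq_trans (leF x y z) _; rewrite xL.
apply: leq_trans (_ : #|[set u in S0 | e x u]| * g <= _)%N; last first.
  by rewrite leq_mul2r degree orbT.
rewrite -sum_nat_const [leqRHS]big_mkcond /=; apply: leq_sum => y _; rewrite inE.
case: ifP => xy; last first.
  rewrite big1 // => z _; apply/eqP; rewrite -leqn0.
  by apply: leq_trans (leF x y z) _; rewrite xL /= andbA xy.
apply: leq_trans (Ag x y); rewrite -sum1_card [leqRHS]big_mkcond /=.
apply: leq_sum => z _; apply: leq_trans (leF x y z) _.
by rewrite xL /= andbA xy /=; case: (z \in _).
Qed.

Let sum_triple (F : V * (V * V) -> nat) :
  (\sum_t F t = \sum_v \sum_u \sum_u' F (v, (u, u')))%N.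
Proof.
under [RHS]eq_bigr do rewrite pair_big /=.
by rewrite pair_big /=; apply: eq_bigr => -[v [u u']].
Qed.

Let tight_count b : (\sum_(t | tight t)
  ((part t.1 == b) + (part t.2.1 == b) + (part t.2.2 == b)) <= 3 * (q * (D * g)))%N.
Proof.
have loc x y : (#|[set z in S0 | e x z & pt z == pt y]| <= g)%N by apply: local.
rewrite !big_split /= !mulSn mul0n addn0 addnA; apply: leq_add; first apply: leq_add.
- rewrite big_mkcond sum_triple.
  apply: (count3 (b := b) (A := fun x y => [set z in S0 | e x z & pt z == pt y])) => // v u u'.
  rewrite /tight /L /= !inE; case: ifP => // /and5P[-> -> -> -> /and3P[-> /eqP-> _]].
  by rewrite eqxx; case: (_ == b).
- rewrite big_mkcond sum_triple exchange_big /=.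
  apply: (count3 (b := b) (A := fun x y => [set z in S0 | e y z & pt z == pt x])) => // u v u'.
  rewrite /tight /L /= !inE; case: ifP => // /and5P[-> -> -> evu /and3P[-> /eqP-> _]].
  by rewrite e_sym evu eqxx; case: (_ == b).
- rewrite big_mkcond sum_triple; under eq_bigr do rewrite exchange_big /=.
  rewrite exchange_big /=.
  apply: (count3 (b := b) (A := fun x y => [set z in S0 | e y z & pt z == pt x])) => // u v u'.
  rewrite /tight /L /= !inE; case: ifP => // /and5P[-> -> -> evu /and3P[evu' /eqP-> _]].
  by rewrite e_sym evu evu' eqxx; case: (_ == b).
Qed.

Lemma sparsify : exists S : {set V}, [/\ S \subset S0,
    forall i, #|[set x in S | pt x == i]| = n.+1,
    forall v, v \in S -> (#|[set u in S | e v u]| <= a1)%N &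
    forall v i, v \in S -> (#|[set u in S | e v u & pt u == i]| <= 1)%N].
Proof.
have K0 : 0 <= K by apply: le_trans K_ge1.
have Kq0 : 0 <= K / q%:R by rewrite divr_ge0.
have lam1 : 0 < 1 + lam by rewrite ltr_wpDr.
have q0 : q%:R != 0 :> R by rewrite pnatr_eq0 -lt0n.
have qp : 0 < q%:R :> R by rewrite ltr0n.
have [||X [pX good]] := @flawless_picks R _ V L q q_gt0 cardL _ P M H a
  lam K lam_ge0 K_ge1.
- move=> [v|p] _; left.
    by exists (part v); rewrite /= eqxx.
  by exists (part p.1); rewrite /= eqxx.
- move=> b; apply: le_trans small; rewrite big_sumType /=; apply: lerD.
    set W := (1 + lam) ^- a1 * _.
    have W0 : 0 <= W by rewrite mulr_ge0 ?expR_ge0 // invr_ge0 exprn_ge0 // ltW.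
    apply: (@le_trans _ _ (\sum_(v in S0) (W * (K / q%:R)) *
       ((part v == b)%:R + (1 + lam) * (K / q%:R) * #|[set u | e v u] :&: L b|%:R))).
      apply: ler_sum => v vS.
      have hD : (\sum_c #|H (inl v) c :&: L c| <= D)%N.
        apply: leq_trans (degree v); rewrite -[leqRHS](sum_card_fibers _ part).
        apply: leq_sum => c _; apply: subset_leq_card; apply/subsetP => u.
        by rewrite !inE => /and3P[-> -> ->].
      have le2 := @flaw_wt_le R _ _ L q _ M H a lam K lam_ge0 K_ge1 (inl v) _ hD.
      apply: ler_pM.
      + rewrite /flaw_wt mulr_ge0 ?invr_ge0 ?exprn_ge0 ?(ltW lam1) //.
        apply: prodr_ge0 => c _; case: ifP => // _.
        by rewrite addr_ge0 // mulr_ge0 // mulr_ge0.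
      + by case: ifP => // _; rewrite mulr_ge0 // mulr_ge0 // ltW.
      + apply: le_trans le2 _.
        have -> : [set c | isSome (M (inl v) c)] = [set part v].
          by apply/setP => c; rewrite !inE /=; case: eqP.
        rewrite cards1 expr1 /W /= mulrAC le_eqVlt; apply/orP; left; apply/eqP.
        by congr (_ * expR _ * _); field.
      + rewrite eq_sym; case: (part v == b) => /=; last by rewrite add0r.
        by rewrite lerDl mulr_ge0 // mulr_ge0 // ltW.
    (* Part [b] is the forced index for its own [q] vertices, and [sum_nbr] bounds its possible hits
       over all [v] by [q * D]. *)
    rewrite -mulr_sumr -mulrA ler_wpM2l // big_split /= -mulr_sumr -!natr_sum sum_part.
    rewrite (_ : K * (1 + (1 + lam) * K * (D%:R / q%:R)) =
        K / q%:R * (q%:R + (1 + lam) * (K / q%:R) * (q * D)%N%:R)).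
      apply: ler_wpM2l => //; rewrite lerD2l; apply: ler_wpM2l.
        by rewrite mulr_ge0 // ltW.
      by rewrite ler_nat.
    by rewrite natrM; field.
  apply: (@le_trans _ _ (\sum_(t | tight t) (K / q%:R) ^+ 3 *
     ((part t.1 == b) + (part t.2.1 == b) + (part t.2.2 == b))%N%:R)).
    apply: ler_sum => t ti.
    have h0 : (\sum_c #|H (inr t) c :&: L c| <= 0)%N.
      by rewrite big1 // => c _; rewrite set0I cards0.
    have := @flaw_wt_le R _ _ L q _ M H a lam K lam_ge0 K_ge1 (inr t) _ h0.
    rewrite expr0 invr1 mul1r mulr0 expR0 mulr1.
    have -> : [set c | isSome (M (inr t) c)] = part t.1 |: [set part t.2.1; part t.2.2].
      by apply/setP => c; rewrite !inE /=; do 3 (case: eqP => //= _).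
    (* The three parts are distinct, since edges leave the block and the bins of the two neighbours
       differ; so three values are forced, at weight [(K / q) ^ 3]. *)
    have/and5P[_ _ _ e1 /and3P[e2 pu bu]] := ti.
    rewrite cardsU1 cards2 !inE /part !xpair_eqE (negPf (e_blocks e1)).
    rewrite (negPf (e_blocks e2)) pu (negPf bu) /= => le2.
    rewrite set0I cards0 mulr0 -!/(part _).
    rewrite ![part _ == b]eq_sym; case: (b == part t.1) => /=.
      rewrite mulr1; apply: le_trans le2 _.
      by rewrite ler_peMr ?exprn_ge0 // ler1n -addnA.
    case: (b == part t.2.1) => /=.
      rewrite mulr1; apply: le_trans le2 _.
      by rewrite ler_peMr ?exprn_ge0 // ler1n.
    case: (b == part t.2.2) => /=; last by rewrite !mulr0.
    by rewrite mulr1; apply: le_trans le2 _; rewrite mulr1.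
  rewrite -mulr_sumr -natr_sum.
  apply: (@le_trans _ _ ((K / q%:R) ^+ 3 * (3 * (q * (D * g)))%N%:R)).
    by rewrite ler_wpM2l ?exprn_ge0 // ler_nat.
  by rewrite !natrM le_eqVlt; apply/orP; left; apply/eqP; field.
have XL c : X c \in S0 /\ part (X c) = c.
  by have /forallP/(_ c) := pX; rewrite inE => /andP[-> /eqP->].
pose S := [set x in S0 | X (part x) == x].
exists S; split.
- by apply/subsetP => x; rewrite inE => /andP[].
- move=> i; rewrite -[RHS]card_ord -(card_imset _ (f := fun k => X (i, k))); last first.
    by move=> k k' Xk; have [_] := XL (i, k); rewrite Xk (proj2 (XL _)) => -[].
  apply: eq_card => x; rewrite !inE; apply/andP/imsetP.
    by case=> /andP[xS /eqP Xx] /eqP xi; exists (bin x) => //; rewrite -{1}Xx /part xi.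
  case=> k _ ->; have [-> Xp] := XL (i, k); rewrite Xp eqxx.
  by case: Xp => ->.
- move=> v; rewrite inE => /andP[vS /eqP Xv].
  have fo : forced M (inl v) X setT.
    by apply/forallP => c /=; case: eqP => // ->; rewrite inE Xv eqxx.
  have /ltnW := good (inl v) vS fo; apply: leq_trans.
  (* A sampled vertex is determined by its part, so sampled neighbours may be counted as hits. *)
  rewrite -(card_in_imset (f := part)).
    apply: subset_leq_card; apply/subsetP => c /imsetP[u].
    rewrite !inE => /andP[/andP[uS /eqP Xu] evu] ->.
    rewrite Xu evu andbT /= /part xpair_eqE eq_sym.
    by rewrite (negPf (e_blocks evu)).
  move=> u u'; rewrite !inE => /andP[/andP[_ /eqP Xu] _] /andP[/andP[_ /eqP Xu'] _] pu.
  by rewrite -Xu pu.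
- move=> v i; rewrite inE => /andP[vS /eqP Xv]; rewrite leqNgt; apply/negP.
  case/card_gt1P => u [u' []]; rewrite !inE.
  case/and3P=> /andP[uS /eqP Xu] vu /eqP ui /and3P[/andP[u'S /eqP Xu'] vu' /eqP u'i] uu'.
  have ti : tight (v, (u, u')).
    rewrite /tight /= vS uS u'S vu vu' ui u'i eqxx /=.
    by apply: contra uu' => /eqP bb; rewrite -Xu -Xu' /part ui u'i bb.
  suff fo : forced M (inr (v, (u, u'))) X setT by have := good (inr (v, (u, u'))) ti fo.
  apply/forallP => c /=.
  by do 3 (case: eqP => [->|_]; first by rewrite inE ?Xv ?Xu ?Xu' eqxx).
Qed.
End Sparsify.

(** * Choice of the constants *)

Lemma nat_ceil (R : realType) (x : R) : 0 <= x ->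
  exists n : nat, [/\ (0 < n)%N, x <= n%:R & n%:R <= x + 1].
Proof.
move=> x0; exists (Num.truncn x).+1; have /andP[le lt] := truncn_itv x0.
by split=> //; [apply: ltW | rewrite -natr1 lerD2r].
Qed.

(** The cubic term of the exponential series. Cubic decay is enough: the factors to be beaten below
    grow at most quadratically. *)
Lemma expRN_le_cube (R : realType) (y : R) : 0 < y -> expR (- y) <= 6 / y ^+ 3.
Proof.
move=> y0; rewrite expRN -[6 / _]invrK lef_pV2 ?posrE ?invr_gt0 ?divr_gt0 ?exprn_gt0 ?expR_gt0 //.
apply: le_trans (expR_ge1Dxn 2 (ltW y0)).
by rewrite invf_div (_ : 3`! = 6)%N // lerDr.
Qed.

(* Since [1 + lam >= exp (lam / (1 + lam))], an excess factor [(1 + lam) ^ 3]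
   over the mean [x] beats the exponential moment. *)
Lemma tail_le (R : realType) (lam x : R) (a : nat) : 0 < lam -> 0 <= x ->
    (1 + lam) ^+ 3 * x <= a%:R ->
  (1 + lam) ^- a * expR ((1 + lam) * lam * x) <= expR (- (lam ^+ 2 * x)).
Proof.
move=> lam0 x0 ax; have r0 : 0 < 1 + lam by rewrite ltr_wpDr // ltW.
apply: (@le_trans _ _ (expR (- (lam / (1 + lam)) * a%:R) * expR ((1 + lam) * lam * x))).
  rewrite ler_wpM2r ?expR_ge0 // expRM_natr -exprVn.
  rewrite lerXn2r ?nnegrE ?invr_ge0 ?expR_ge0 ?(ltW r0) //.
  apply: le_trans (expR_ge1Dx _); rewrite le_eqVlt; apply/orP; left; apply/eqP.
  by field; rewrite gt_eqF.
rewrite -expRD ler_expR mulNr addrC.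
have h : (1 + lam) ^+ 2 * lam * x <= lam / (1 + lam) * a%:R.
  rewrite (_ : _ * x = lam / (1 + lam) * ((1 + lam) ^+ 3 * x)).
    by rewrite ler_wpM2l // divr_ge0 // ltW.
  by field; rewrite gt_eqF.
have h2 : 0 <= lam ^+ 3 * x by rewrite mulr_ge0 // exprn_ge0 // ltW.
nra.
Qed.

(* The constants [2048 * lam] and [128 * lam] stand for [eps] and [eps / 16]. *)
Lemma size_budget (R : realType) (lam T N theta a1 a2 a3 : R) (p := (1 + lam) ^+ 3) :
    0 < lam -> 2048 * lam <= 1 -> 0 < T -> 0 < theta ->
    64 + 9 * T <= N * (128 * lam) -> theta * (1 + 1024 * lam) = N ->
    a1 <= p * theta + 1 -> a2 * T <= p * a1 + T -> a3 <= p * a2 + 1 ->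
  T * a3 <= (1 - 128 * lam) * N.
Proof.
move=> lam0 lam1 T0 th0 NT thN a1le a2le a3le.
have [p1 p7] : 1 <= p /\ p <= 1 + 7 * lam.
  by rewrite /p; clear - lam0 lam1; split; nra.
have p3 : p ^+ 3 <= 1 + 511 * lam.
  have : p ^+ 3 <= (1 + 7 * lam) ^+ 3.
    by rewrite lerXn2r ?nnegrE //; clear - lam0 p1 p7; lra.
  by move/le_trans; apply; clear - lam0 lam1; nra.
move: p p1 p7 p3 a1le a2le a3le => p p1 p7 p3 a1le a2le a3le.
have p0 : 0 <= p by apply: le_trans p1.
have h1 : T * a3 <= p * (a2 * T) + T.
  have := ler_wpM2l (ltW T0) a3le; rewrite mulrDr mulr1; clear; lra.
have h2 : p * (a2 * T) <= p * (p * a1 + T) by rewrite ler_wpM2l.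
have h3 : p * (p * a1) <= p * (p * (p * theta + 1)) by rewrite ler_wpM2l ?ler_wpM2l.
have h4 : p * (p * (p * theta + 1)) = p ^+ 3 * theta + p ^+ 2 by ring.
have h5 : p ^+ 3 * theta <= (1 + 511 * lam) * theta by rewrite ler_wpM2r // ltW.
have h6 : (1 + 511 * lam) * theta <= (1 - 256 * lam) * N.
  rewrite -thN mulrCA mulrC; clear - lam0 lam1 th0; rewrite ler_pM2l //; nra.
have p8 : p <= 8 by clear - p7 lam1; lra.
have h7 : p ^+ 2 <= 64 by clear - p8 p0; nra.
have h8 : p * T <= 8 * T by rewrite ler_wpM2r // ltW.
clear - h1 h2 h3 h4 h5 h6 h7 h8 NT; lra.
Qed.

Lemma sample_bound (R : realType) (lam theta : R) : 0 < lam -> 1 <= theta ->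
  240 <= lam ^+ 7 * theta ->
  6 / (lam ^+ 2 * theta) ^+ 3 * (2 * (1 + 4 * theta)) <= lam / 4.
Proof.
move=> lam0 th1 big; have th0 : 0 < theta by apply: lt_le_trans th1.
rewrite mulrAC ler_pdivrMr ?exprn_gt0 ?mulr_gt0 ?exprn_gt0 //.
rewrite (_ : lam / 4 * _ = lam ^+ 7 * theta * theta ^+ 2 / 4); last by field.
have : 240 * theta ^+ 2 <= lam ^+ 7 * theta * theta ^+ 2.
  by rewrite ler_wpM2r // exprn_ge0 // ltW.
clear - th1; nra.
Qed.

(** As [a1] is at least [N / 2], the left side is of order [T ^ 3 / (lam ^ 6 * N)], small once [N]
    is large against [T]. *)
Lemma class_bound (R : realType) (lam T N a1 : R) : 0 < lam -> 0 < T -> 0 < a1 ->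
    N <= 2 * a1 -> 0 < N -> 480 * T ^+ 3 <= lam ^+ 7 * N ->
  6 / (lam ^+ 2 * (a1 / T)) ^+ 3 * (4 * (N * a1)) <= lam / 2.
Proof.
move=> lam0 T0 a10 Na1 N0 big.
have l7 : 0 < lam ^+ 7 by apply: exprn_gt0.
rewrite mulrAC ler_pdivrMr; last by rewrite exprn_gt0 // mulr_gt0 ?exprn_gt0 // divr_gt0.
rewrite (_ : lam / 2 * _ = lam ^+ 7 * a1 ^+ 3 / 2 / T ^+ 3); last first.
  by field; rewrite gt_eqF.
rewrite ler_pdivlMr ?exprn_gt0 //.
have h1 : 480 * T ^+ 3 <= lam ^+ 7 * (2 * a1).
  by apply: le_trans big _; rewrite ler_pM2l.
have h2 : 480 * T ^+ 3 * (N * a1) <= lam ^+ 7 * (2 * a1) * (2 * a1 * a1).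
  apply: ler_pM => //.
  - by rewrite mulr_ge0 // exprn_ge0 // ltW.
  - by rewrite mulr_ge0 // ltW.
  - by rewrite ler_pM2r.
rewrite (_ : 6 * _ * _ = 480 * T ^+ 3 * (N * a1) / 20); last by field.
have h3 : 0 <= lam ^+ 7 * a1 ^+ 3 by rewrite mulr_ge0 ?exprn_ge0 // ltW.
by clear - h2 h3; lra.
Qed.

Lemma round_bound (R : realType) (lam T N m a1 a2 : R) :
    0 < lam -> 2048 * lam <= 1 -> 0 < T -> T <= N -> 0 < N -> 1 <= a1 -> 0 < m ->
    2400 <= T * (128 * lam * lam) -> 128 * lam * N <= m ->
    a1 <= 9 * N -> a2 * T <= 8 * a1 + T -> a1 <= a2 * T -> 240 * T ^+ 3 <= lam ^+ 7 * a1 ->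
  2 * (1 + lam) ^+ 2 * a2 / m + 6 / (lam ^+ 2 * a2) ^+ 3 * (4 * a1) <= lam / 2.
Proof.
move=> lam0 lam1 T0 TN N0 a11 m0 Tge mge a1le a2le a2ge big.
have l7 : 0 < lam ^+ 7 by apply: exprn_gt0.
have T3 : 0 < T ^+ 3 by apply: exprn_gt0.
have a20 : 0 < a2 by rewrite -(pmulr_lgt0 _ T0); apply: lt_le_trans a2ge; apply: lt_le_trans a11.
have h1 : 2 * (1 + lam) ^+ 2 * a2 / m <= lam / 4.
  rewrite ler_pdivrMr // -(ler_pM2r T0).
  have h2 : 2 * (1 + lam) ^+ 2 <= 8 by clear - lam0 lam1; nra.
  (* [73] is [8 * 9 + 1]: [a2 * T] is at most a constant times [N], while [m] is at least
     [128 * lam * N], so a large [T] makes the quotient small. *)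
  have h3 : 2 * (1 + lam) ^+ 2 * a2 * T <= 8 * (73 * N).
    rewrite -mulrA; apply: ler_pM => //.
    - by rewrite mulr_ge0 // exprn_ge0 // addr_ge0 // ltW.
    - by rewrite mulr_ge0 // ltW.
    - by clear - a2le a1le TN; lra.
  have h4 : 2400 * N <= T * (128 * lam * lam) * N by rewrite ler_pM2r.
  have h5 : T * lam * (128 * lam * N) <= T * lam * m by rewrite ler_pM2l // mulr_gt0.
  have h6 : T * (128 * lam * lam) * N = T * lam * (128 * lam * N) by ring.
  have h7 : lam / 4 * m * T = T * lam * m / 4 by field.
  by clear - h3 h4 h5 h6 h7 N0; lra.
have h2 : 6 / (lam ^+ 2 * a2) ^+ 3 * (4 * a1) <= lam / 4.
  rewrite mulrAC ler_pdivrMr ?exprn_gt0 ?mulr_gt0 ?exprn_gt0 //.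
  rewrite (_ : lam / 4 * _ = lam ^+ 7 * a2 ^+ 3 / 4); last by field.
  rewrite -(ler_pM2r T3).
  have a10 : 0 < a1 by apply: lt_le_trans a11.
  have h4 : a1 ^+ 3 <= (a2 * T) ^+ 3.
    by rewrite lerXn2r ?nnegrE // ?mulr_ge0 // ltW.
  have h6 : 240 * T ^+ 3 * a1 <= lam ^+ 7 * a1 * (a1 * a1).
    have aa : a1 <= a1 * a1 by rewrite ler_peMl // ltW.
    by apply: (ler_pM _ (ltW a10) big aa); rewrite mulr_ge0 // ltW.
  have h7 : lam ^+ 7 * a1 ^+ 3 <= lam ^+ 7 * (a2 * T) ^+ 3 by rewrite ler_pM2l.
  have h8 : lam ^+ 7 * (a2 * T) ^+ 3 = lam ^+ 7 * a2 ^+ 3 * T ^+ 3 by ring.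
  have h9 : lam ^+ 7 * a1 * (a1 * a1) = lam ^+ 7 * a1 ^+ 3 by ring.
  have h10 : 0 <= T ^+ 3 * a1 by rewrite mulr_ge0 // ltW.
  by clear - h6 h7 h8 h9 h10; lra.
by clear - h1 h2; lra.
Qed.

(** [K] is [1 + lam]. First [T] is chosen from [lam], then [n.+1] large against [T]; [a1], [a2],
    [a3] exceed the respective means by the factor [(1 + lam) ^ 3], rounded up, and [m] is what [T]
    rounds leave of a block. [theta] will bound the mean degree of the sample. The first estimate
    leaves half of [1 - K^-1] to the tight triples. *)
Lemma parameters (R : realType) (lam : R) : 0 < lam -> 2048 * lam <= 1 ->
  exists (n m a1 a2 a3 T : nat) (theta := n.+1%:R / (1 + 1024 * lam)),
  [/\ [&& 0 < m, 0 < a2, 0 < a3 & 0 < T]%N,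
     (T * a3 + m <= n.+1)%N &
  [/\ (1 + lam) ^- a1 * expR ((1 + lam) * lam * theta) *
       ((1 + lam) * (1 + (1 + lam) * (1 + lam) * theta)) <= (1 - (1 + lam)^-1) / 2,
  (1 + lam) ^- a2 * expR ((1 + lam) / T%:R * lam * a1%:R) *
    ((1 + lam) * (1 + lam) * (n.+1 * a1)%N%:R) <= 1 - (1 + lam)^-1 &
  2 * (1 + lam) ^+ 2 * a2%:R / m%:R + (1 + lam) ^- a3 *
    expR ((1 + lam) * lam * a2%:R) * ((1 + lam) * (1 + lam) * a1%:R) <=
    1 - (1 + lam)^-1]].
Proof.
move=> lam0 lam1.
have r0 : 0 < 1 + lam by rewrite addr_gt0.
have l7 := exprn_gt0 7 lam0.
have [T [T0 Tge _]] : exists T : nat, [/\ (0 < T)%N,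
    2400 / (128 * lam * lam) <= T%:R & T%:R <= 2400 / (128 * lam * lam) + 1].
  by apply: nat_ceil; rewrite divr_ge0 // !mulr_ge0 // ltW.
have Tp : 0 < T%:R :> R by rewrite ltr0n.
have T1 : 1 <= T%:R :> R by rewrite ler1n.
have T3 : 1 <= T%:R ^+ 3 :> R by apply: exprn_ege1.
have T30 : 0 < T%:R ^+ 3 :> R by apply: exprn_gt0.
(* [b1] is what [size_budget] demands of the block size, [b2] what the tail estimates demand. *)
pose b1 := (64 + 9 * T%:R) / (128 * lam); pose b2 := 480 * T%:R ^+ 3 / lam ^+ 7.
have b10 : 0 <= b1 by rewrite divr_ge0 ?addr_ge0 // mulr_ge0 // ltW.
have b20 : 0 <= b2 by rewrite divr_ge0 ?mulr_ge0 // ltW.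
have [[|n] [n0 nge _]] := nat_ceil (addr_ge0 b10 b20); first by [].
have [N1 NE] : 1 <= n.+1%:R :> R /\ exists N : R, N = n.+1%:R.
  by split; [rewrite ler1n|exists n.+1%:R].
case: NE => N NE; rewrite -NE in nge N1.
have N0 : 0 < N by apply: lt_le_trans N1.
have n1 : b1 <= N by apply: le_trans nge; rewrite lerDl.
have n2 : b2 <= N by apply: le_trans nge; rewrite lerDr.
move: n1; rewrite ler_pdivrMr ?mulr_gt0 // => n1.
move: n2; rewrite ler_pdivrMr // [N * _]mulrC => n2.
move: Tge; rewrite ler_pdivrMr ?mulr_gt0 ?mulr_gt0 // => Tge.
have TN : T%:R <= N.
  have : N * (128 * lam) <= N by rewrite ler_piMr ?(ltW N0) //; clear - lam1 lam0; lra.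
  by clear - n1 T1; lra.
have d0 : 0 < 1 + 1024 * lam by clear - lam0; lra.
pose theta := N / (1 + 1024 * lam).
have thetaE : theta * (1 + 1024 * lam) = N by rewrite divfK // gt_eqF.
have th0 : 0 < theta by rewrite divr_gt0.
have Nth : N <= 2 * theta by rewrite -thetaE mulrC ler_pM2r //; clear - lam1; lra.
have thN : theta <= N by rewrite -thetaE ler_peMr ?(ltW th0) //; clear - lam0; lra.
have [p1 p8] : 1 <= (1 + lam) ^+ 3 /\ (1 + lam) ^+ 3 <= 8.
  by clear - lam0 lam1; split; nra.
have p0 : 0 <= (1 + lam) ^+ 3 by apply: le_trans p1.
have [a1 [a10 a1ge a1le]] := nat_ceil (mulr_ge0 p0 (ltW th0)).
have a1p : 1 <= a1%:R :> R by rewrite ler1n.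
have [a2 [a20 a2ge a2le]] := nat_ceil (mulr_ge0 p0 (divr_ge0 (ler0n R a1) (ltW Tp))).
have [a3 [a30 a3ge a3le]] := nat_ceil (mulr_ge0 p0 (ler0n R a2)).
have a2T : a2%:R * T%:R <= (1 + lam) ^+ 3 * a1%:R + T%:R.
  rewrite -(ler_pM2r Tp) in a2le; apply: le_trans a2le _; rewrite mulrDl mul1r -mulrA.
  by rewrite divfK // gt_eqF.
have a2a1 : a1%:R <= a2%:R * T%:R :> R.
  by rewrite -(ler_pdivrMr _ _ Tp); apply: le_trans a2ge; rewrite ler_peMl // divr_ge0.
have a1th : theta <= a1%:R by apply: le_trans a1ge; rewrite ler_peMl // ltW.
have Ta3 : T%:R * a3%:R <= (1 - 128 * lam) * N by apply: size_budget thetaE a1le a2T a3le.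
have Ta3N : (T * a3 <= n.+1)%N.
  rewrite -(ler_nat R) natrM -NE; apply: le_trans Ta3 _.
  by rewrite ler_piMl ?(ltW N0) // gerBl mulr_ge0 // ltW.
have mE : (n.+1 - T * a3)%N%:R = N - T%:R * a3%:R by rewrite natrB // natrM NE.
have mge : 128 * lam * N <= (n.+1 - T * a3)%N%:R by rewrite mE; clear - Ta3; lra.
have m0 : 0 < (n.+1 - T * a3)%N%:R :> R by apply: lt_le_trans mge; rewrite !mulr_gt0.
have rV : lam / 2 <= 1 - (1 + lam)^-1.
  rewrite (_ : 1 - _ = lam / (1 + lam)); last by field; rewrite gt_eqF.
  by rewrite ler_pM2l // lef_pV2 ?posrE //; clear - lam1 lam0; lra.
have tail x a : 0 < x -> (1 + lam) ^+ 3 * x <= a%:R ->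
    (1 + lam) ^- a * expR ((1 + lam) * lam * x) <= 6 / (lam ^+ 2 * x) ^+ 3.
  move=> x0 ax; apply: le_trans (tail_le lam0 (ltW x0) ax) (expRN_le_cube _).
  by rewrite mulr_gt0 ?exprn_gt0.
have t0 (a : nat) x : 0 <= (1 + lam) ^- a * expR x :> R.
  by rewrite mulr_ge0 ?expR_ge0 // invr_ge0 exprn_ge0 // ltW.
have r22 : (1 + lam) * (1 + lam) <= 4 by clear - lam0 lam1; nra.
exists n, (n.+1 - T * a3)%N, a1, a2, a3, T => th.
have -> : th = theta by rewrite /th /theta NE.
rewrite -(ltr_nat R) m0 a20 a30 T0 subnKC //.
split=> //; split.
- have r2 := addr_ge0 ler01 (mulr_ge0 (mulr_ge0 (ltW r0) (ltW r0)) (ltW th0)).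
  have r1 : 2 * (1 + 4 * theta) >= (1 + lam) * (1 + (1 + lam) * (1 + lam) * theta).
    apply: ler_pM; rewrite ?(ltW r0) //.
    + by clear - lam0 lam1; lra.
    + by rewrite lerD2l ler_pM2r.
  apply: le_trans (ler_pM (t0 _ _) _ (tail theta a1 th0 a1ge) r1) _.
    exact: mulr_ge0 (ltW r0) r2.
  apply: le_trans (sample_bound lam0 _ _) _.
  + by clear - Nth n2 n1 T1 lam0 lam1 N0; nra.
  + have : lam ^+ 7 * N <= lam ^+ 7 * (2 * theta) by rewrite ler_pM2l.
    by clear - n2 T3; lra.
  + by clear - rV; lra.
- apply: le_trans rV.
  have -> : (1 + lam) / T%:R * lam * a1%:R = (1 + lam) * lam * (a1%:R / T%:R).
    by field; rewrite gt_eqF.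
  have at0 : 0 < a1%:R / T%:R :> R by rewrite divr_gt0 // ltr0n.
  apply: le_trans (ler_pM (t0 _ _) _ (tail _ _ at0 a2ge) (_ : _ <= 4 * (N * a1%:R))) _.
  + by rewrite !mulr_ge0 ?(ltW r0).
  + by rewrite natrM -NE ler_wpM2r // mulr_ge0 // ltW.
  + apply: class_bound => //; first by rewrite ltr0n.
    by apply: le_trans Nth _; rewrite ler_pM2l.
- apply: le_trans rV.
  apply: le_trans (_ : 2 * (1 + lam) ^+ 2 * a2%:R / (n.+1 - T * a3)%N%:R +
    6 / (lam ^+ 2 * a2%:R) ^+ 3 * (4 * a1%:R) <= _).
    rewrite lerD2l; apply: ler_pM => //.
    + by rewrite !mulr_ge0 ?(ltW r0).
    + by apply: tail => //; rewrite ltr0n.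
    + by rewrite ler_wpM2r.
  apply: (round_bound (T := T%:R) (N := N)) => //.
  + have : (1 + lam) ^+ 3 * theta <= 8 * theta by rewrite ler_pM2r.
    by clear - a1le thN N1; lra.
  + have : (1 + lam) ^+ 3 * a1%:R <= 8 * a1%:R by rewrite ler_wpM2r.
    by clear - a2T; lra.
  + have : lam ^+ 7 * N <= lam ^+ 7 * (2 * a1%:R).
      by rewrite ler_pM2l //; apply: le_trans Nth _; rewrite ler_pM2l.
    by clear - n2; lra.
Qed.

(** The sample has [n.+1] vertices per block and degree bound [a1], both depending on [eps] only, so
    [sparse_transversal] applies with constants independent of [D]. *)
Theorem locally_sparse_transversal (R : realType) (eps : R) : 0 < eps -> eps <= 1 ->
  exists delta : R, 0 < delta /\ exists D0 : nat, forall D g : nat, (D0 <= D)%N ->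
  g%:R <= delta * D%:R ->
  forall (V I : finType) (pt : V -> I) (e : rel V) (A : {set V}),
    symmetric e -> (forall u v, e u v -> pt u != pt v) ->
    (forall i, (1 + eps) * D%:R <= #|[set x in A | pt x == i]|%:R) ->
    (forall v, #|[set u in A | e v u]| <= D)%N ->
    (forall v i, #|[set u in A | e v u & pt u == i]| <= g)%N ->
  exists X : {ffun I -> V}, (forall i, X i \in A /\ pt (X i) = i) /\
    forall i j, i != j -> ~~ e (X i) (X j).
Proof.
move=> e0 e1; pose lam := eps / 2048.
have lamE : eps = 2048 * lam by rewrite /lam; lra.
have lam0 : 0 < lam by rewrite divr_gt0.
rewrite {}lamE in e1 e0 *; clearbody lam; move: lam lam0 e1 {eps e0} => lam lam0 lam1.
have [n [m [a1 [a2 [a3 [T]]]]]] := parameters lam0 lam1.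
move=> [/and4P[m0 a20 a30 T0] nge [small1 small2 small3]].
set theta := n.+1%:R / _ in small1.
have lam0' := ltW lam0.
have r0 : 0 < 1 + lam by rewrite addr_gt0.
have K1 : 1 <= 1 + lam by rewrite lerDl.
have d0 : 0 < 1 + 1024 * lam by rewrite addr_gt0 // mulr_gt0.
have th0 : 0 < theta by rewrite divr_gt0.
have c0 : 0 < 1 - (1 + lam)^-1 by rewrite subr_gt0 invf_lt1 // ltrDl.
have k0 : 0 < 6 * (1 + lam) ^+ 3 * theta ^+ 2.
  by rewrite (mulr_gt0 _ (exprn_gt0 2 th0)) // (mulr_gt0 _ (exprn_gt0 3 r0)).
(* Chosen so that the tight triples use exactly half of [1 - K^-1]. *)
pose delta := (1 - (1 + lam)^-1) / (6 * (1 + lam) ^+ 3 * theta ^+ 2).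
have delta0 : 0 < delta by rewrite divr_gt0.
exists delta; split=> //.
(* From [D0] on, [n.+1] is at most [1024 * lam * D], so rounding [q] down costs at most half of the
   surplus [2048 * lam * D]. *)
have [D0 [D00 D0ge _]] := nat_ceil (divr_ge0 (ler0n R n.+1) (mulr_ge0 (ler0n R 1024) lam0')).
exists D0 => D g DD0 gD V I pt e A e_sym e_blocks big deg loc.
have DD0' : D0%:R <= D%:R :> R by rewrite ler_nat.
have Dp : 0 < D%:R :> R by rewrite ltr0n; apply: leq_trans DD0.
have nD : n.+1%:R <= 1024 * lam * D%:R.
  rewrite mulrC -ler_pdivrMr ?mulr_gt0 //; exact: le_trans D0ge DD0'.
have x0 : 0 <= (1 + 2048 * lam) * D%:R / n.+1%:R.
  by rewrite divr_ge0 // mulr_ge0 // addr_ge0 // mulr_ge0.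
pose q := Num.truncn ((1 + 2048 * lam) * D%:R / n.+1%:R).
have /andP[qle qgt] := truncn_itv x0; rewrite -/q in qle qgt.
have np : 0 < n.+1%:R :> R by rewrite ltr0n.
rewrite ler_pdivlMr // in qle; rewrite ltr_pdivrMr // -[q.+1%:R]natr1 in qgt.
have qn : (1 + 1024 * lam) * D%:R <= q%:R * n.+1%:R.
  by clear - qgt nD; lra.
have q0 : (0 < q)%N.
  have : 0 < q%:R * n.+1%:R :> R by apply: lt_le_trans qn; rewrite mulr_gt0.
  by rewrite pmulr_lgt0 // ltr0n.
have qp : 0 < q%:R :> R by rewrite ltr0n.
have [i|S0 [bin [S0A bins]]] := @equal_bins V I pt A n q.
  by rewrite -(ler_nat R) natrM mulrC; apply: le_trans (big i).
have Dq : D%:R / q%:R <= theta.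
  by rewrite ler_pdivrMr // mulrAC ler_pdivlMr // mulrC [_ * q%:R]mulrC.
have Dq0 : 0 <= D%:R / q%:R :> R by rewrite divr_ge0.
have sub_deg (B C : {set V}) (Q : pred V) (k : nat) : B \subset C ->
    (#|[set u in C | Q u]| <= k -> #|[set u in B | Q u]| <= k)%N.
  move=> /subsetP BC; apply: leq_trans; apply: subset_leq_card.
  by apply/subsetP => u; rewrite !inE => /andP[/BC -> ->].
have [|||S [SS0 Scard Sdeg Sloc]] := @sparsify R V I pt e S0 e_sym e_blocks n q D g a1 bin
   lam (1 + lam) q0 bins _ _ lam0' K1 _.
- by move=> v; apply: sub_deg (deg v).
- by move=> v i; apply: sub_deg (loc v i).
- rewrite [X in _ <= X]splitr; apply: lerD.
    apply: le_trans small1; apply: ler_pM.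
    + by rewrite mulr_ge0 ?expR_ge0 // invr_ge0 exprn_ge0 // ltW.
    + by rewrite mulr_ge0 ?(ltW r0) // addr_ge0 // mulr_ge0 // mulr_ge0 // ltW.
    + rewrite ler_wpM2l ?invr_ge0 ?exprn_ge0 ?(ltW r0) // ler_expR ler_wpM2l //.
      by rewrite mulr_ge0 // ltW.
    + by rewrite ler_wpM2l ?(ltW r0) // lerD2l ler_wpM2l // mulr_ge0 // ltW.
  have gq : g%:R / q%:R <= delta * theta.
    apply: (@le_trans _ _ (delta * (D%:R / q%:R))); last by rewrite ler_pM2l.
    by rewrite mulrA ler_wpM2r // invr_ge0.
  apply: (@le_trans _ _ (3 * (1 + lam) ^+ 3 * theta * (delta * theta))).
    apply: ler_pM => //; first by rewrite mulr_ge0 // mulr_ge0 // exprn_ge0 // ltW.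
      by rewrite divr_ge0.
    by rewrite ler_wpM2l // mulr_ge0 // exprn_ge0 // ltW.
  rewrite /delta le_eqVlt; apply/orP; left; apply/eqP.
  by field; rewrite !gt_eqF.
(* [sparsify] bounds degrees only for vertices of [S], but [sparse_transversal] asks for all
   vertices; edges leaving [S] are therefore deleted. *)
pose e' : rel V := fun u v => [&& u \in S, v \in S & e u v].
have e'S v Q : [set u in S | e' v u & Q u] \subset
    if v \in S then [set u in S | e v u & Q u] else set0.
  apply/subsetP => u; rewrite !inE /e' => /and3P[uS /and3P[vS _ evu] Qu].
  by rewrite vS inE uS evu.
have [||||X [XS Xe]] := @sparse_transversal R V I pt e' S _ _ n.+1 m a1 a2 a3 T lam (1 + lam)
  m0 a20 a30 T0 nge Scard _ _ lam0' K1 small2 small3.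
- by move=> u v; rewrite /e' e_sym andbCA.
- by move=> u v /and3P[].
- move=> v; have := subset_leq_card (e'S v predT).
  case: ifP => vS; last by rewrite cards0 leqn0; under eq_finset do rewrite andbT; move=> /eqP->.
  under eq_finset do rewrite andbT; move/leq_trans; apply.
  by under eq_finset do rewrite andbT; apply: Sdeg.
- move=> v i; apply: leq_trans (subset_leq_card (e'S v (fun u => pt u == i))) _.
  by case: ifP => vS; [apply: Sloc|rewrite cards0].
exists X; split=> [i|i j ij].
  by have [/(subsetP SS0)/(subsetP S0A) -> ->] := XS i.
apply: contra (Xe i j ij) => eij.
by rewrite /e' eij (proj1 (XS i)) (proj1 (XS j)).
Qed.

(** * Strong colouring *)

Section StrongColouring.
Variables (V I : finType) (pt : V -> I) (e : rel V) (M D g : nat).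
Hypothesis e_sym : symmetric e.
Hypothesis blocks : forall i, #|[set x | pt x == i]| = M.
Hypothesis degree : forall v, (#|[set u | e v u]| <= D)%N.
Hypothesis local : forall v i, (#|[set u | e v u & pt u == i]| <= g)%N.
Hypothesis transversal : forall A : {set V},
    (forall i, M - (D + g) <= #|[set x in A | pt x == i]|)%N ->
  exists X : {ffun I -> V}, (forall i, X i \in A /\ pt (X i) = i) /\
    forall i j, i != j -> ~~ e (X i) (X j).

Implicit Type c : {ffun V -> option 'I_M}.

Definition partial_colouring c : bool :=
  [forall u, forall v, [&& u != v, isSome (c u) & c u == c v] ==>
     (pt u != pt v) && ~~ e u v].

Lemma partial_colouringP c : reflect
  (forall u v, u != v -> c u -> c u = c v -> pt u != pt v /\ ~~ e u v)
  (partial_colouring c).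
Proof.
apply: (iffP forallP) => [H u v uv cu cuv|H u].
  by have /forallP/(_ v) := H u; rewrite uv cu cuv eqxx => /andP.
by apply/forallP => v; apply/implyP => /and3P[uv cu /eqP cuv]; apply/andP; apply: H.
Qed.

(* [v0] receives a colour [al] missing in its block; along an independent transversal
   [t] through [v0], the colour [al] is exchanged with the colour of [t] in each block. *)
Lemma extend_partial_colouring c v0 : partial_colouring c -> c v0 = None ->
  exists2 c', partial_colouring c' & (#|[set v | ~~ c' v]| < #|[set v | ~~ c v]|)%N.
Proof.
move=> /partial_colouringP cP cv0; pose k0 := pt v0.
have same u v al : pt u = pt v -> c u = Some al -> c v = Some al -> u = v.
  move=> puv cu cv; apply/eqP; apply: contraT => uv.
  have [] := cP u v uv; rewrite ?cu ?cv //; by rewrite puv eqxx.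
(* Otherwise all [M] colours would occur among the [M - 1] vertices of the block other than the
   uncoloured [v0]. *)
have [al alP] : exists al, forall u, pt u = k0 -> c u != Some al.
  suff /existsP[al /forallP al0] : [exists al, forall u, (pt u == k0) ==> (c u != Some al)].
    by exists al => u pu; have := al0 u; rewrite pu eqxx.
  apply: contraT => /existsPn no.
  have ex al : exists u, (pt u == k0) && (c u == Some al).
    apply/existsP; apply: contraT => /existsPn nu.
    have /negP[] := no al; apply/forallP => u; apply/implyP => /eqP pu.
    by have := nu u; rewrite pu eqxx.
  have [f fP] := fin_all_exists ex.
  have finj : injective f.
    move=> a b fab; have /andP[_ /eqP] := fP a; rewrite fab.
    by have /andP[_ /eqP->] := fP b => -[].
  have : (M <= #|[set x | pt x == k0] :\ v0|)%N.
    rewrite -[leqLHS]card_ord -(card_imset _ finj); apply: subset_leq_card.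
    apply/subsetP => _ /imsetP[a _ ->]; rewrite !inE; have /andP[-> /eqP ca] := fP a.
    by rewrite andbT; apply/eqP => fv; rewrite fv cv0 in ca.
  have := cardsD1 v0 [set x | pt x == k0]; rewrite blocks inE eqxx; lia.
(* [u] has colour [al] in the block of [w] and would receive the colour of [w], which its neighbour
   [x] already has. *)
pose blocked w := [exists u, [&& pt u == pt w, c u == Some al &
  [exists x, [&& e u x, isSome (c x) & c x == c w]]]].
(* The block of [v0] stays whole, since its transversal vertex is replaced by [v0] afterwards. *)
pose A := [set w | (pt w == k0) || ~~ e v0 w && ~~ blocked w].
have bigA i : (M - (D + g) <= #|[set x in A | pt x == i]|)%N.
  have split_blk : [set x | pt x == i] \subset [set x in A | pt x == i] :|:
      ([set x | blocked x & pt x == i] :|: [set x | e v0 x & pt x == i]).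
    apply/subsetP => x; rewrite !inE => ->; rewrite !andbT.
    by case: (pt x == k0) => //=; case: (e v0 x); case: (blocked x).
  (* Blocked vertices of one block have distinct colours, all occurring on the at most [D]
     neighbours of a single [u]. *)
  have blk_le : (#|[set x | blocked x & pt x == i]| <= D)%N.
    have [->|[w0]] := set_0Vmem [set x | blocked x & pt x == i]; first by rewrite cards0.
    rewrite inE => /andP[/existsP[u /and3P[/eqP pu /eqP cu _]] /eqP pw0].
    have nbr w : w \in [set x | blocked x & pt x == i] ->
        pt w = i /\ exists x, [/\ e u x, isSome (c x) & c x = c w].
      rewrite inE => /andP[/existsP[u' /and3P[/eqP pu' /eqP cu' /existsP[x hx]]] /eqP pw].
      have uu : u' = u by apply: same cu' cu; rewrite pu' pw pu.
      by move: hx; rewrite uu => /and3P[eux cx /eqP cxw]; split=> //; exists x.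
    rewrite -(card_in_imset (f := c)); last first.
      move=> w w' /nbr[pw [x [_ cx cxw]]] /nbr[pw' _] cw.
      have [a ca] : exists a, c x = Some a by case: (c x) cx => // a _; exists a.
      by apply: (same _ _ a); rewrite ?pw ?pw' // -?cw -cxw.
    apply: leq_trans (degree u); apply: leq_trans (leq_imset_card c _).
    apply: subset_leq_card; apply/subsetP => _ /imsetP[w /nbr[_ [x [eux _ <-]]] ->].
    by apply: imset_f; rewrite inE.
  have := subset_leq_card split_blk; rewrite blocks leq_subLR => /leq_trans; apply.
  apply: leq_trans (leq_card_setU _ _) _; rewrite addnC leq_add2r.
  by apply: leq_trans (leq_card_setU _ _) _; rewrite leq_add.
have [X [XA Xe]] := transversal bigA.
pose t i := if i == k0 then v0 else X i.
have pt_t i : pt (t i) = i.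
  by rewrite /t; case: eqP => [->|_] //; case: (XA i).
have tA i : i != k0 -> ~~ e v0 (t i) /\ ~~ blocked (t i).
  move=> ik; have := proj1 (XA i); rewrite inE (proj2 (XA i)) (negPf ik) /=.
  by rewrite /t (negPf ik) => /andP[].
have te i j : i != j -> ~~ e (t i) (t j).
  case: (eqVneq i k0) => [->|ik] ij; first by rewrite {1}/t eqxx; case: (tA j); rewrite // eq_sym.
  case: (eqVneq j k0) => [->|jk]; last by rewrite /t (negPf ik) (negPf jk) Xe.
  by rewrite {2}/t eqxx e_sym; case: (tA i).
pose c' := [ffun x => if x == t (pt x) then Some al
  else if c x == Some al then c (t (pt x)) else c x].
have c't x : x == t (pt x) -> c' x = Some al by rewrite ffunE => ->.
have c'al x : x != t (pt x) -> c x = Some al -> c' x = c (t (pt x)).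
  by rewrite ffunE => /negPf-> ->; rewrite eqxx.
have c'else x : x != t (pt x) -> c x != Some al -> c' x = c x.
  by rewrite ffunE => /negPf-> /negPf->.
have al_k0 x : c x = Some al -> pt x != k0.
  by move=> cx; apply/eqP => /alP; rewrite cx eqxx.
have not_al v : v != t (pt v) -> c' v != Some al.
  move=> vt; case: (eqVneq (c v) (Some al)) => cv; last by rewrite c'else.
  rewrite c'al //; apply/eqP => ct; move/eqP: vt; apply.
  by apply: same cv ct; rewrite pt_t.
(* Here [u] gives up [al] for the colour of [t (pt u)], while [v] keeps its colour; an edge between
   them would make [t (pt u)] blocked. *)
have mixed u v : u != t (pt u) -> v != t (pt v) -> c u = Some al -> c v != Some al ->
    c' u -> c' u = c' v -> pt u != pt v /\ ~~ e u v.
  move=> ut vt cu cv; rewrite c'al // (c'else v) // => cs cc; split.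
    apply/eqP => puv; move/eqP: vt; apply.
    have [a ca] : exists a, c (t (pt u)) = Some a by case: (c _) cs => // a _; exists a.
    by apply: (same _ _ a); rewrite ?pt_t // -?cc // -puv.
  have [_] := tA _ (al_k0 u cu); apply: contra => euv; apply/existsP; exists u.
  rewrite pt_t cu !eqxx /=; apply/existsP; exists v.
  by rewrite euv -cc cs eqxx.
exists c'.
  apply/partial_colouringP => u v uv cu cuv.
  case: (eqVneq u (t (pt u))) => [ut|ut].
    have vt : v == t (pt v).
      by apply: contraT => /not_al; rewrite -cuv c't ?eqxx //; apply/eqP.
    have puv : pt u != pt v.
      by apply: contra uv => /eqP puv; rewrite ut puv -(eqP vt).
    by rewrite ut (eqP vt) te // pt_t pt_t.
  case: (eqVneq v (t (pt v))) => [vt|vt].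
    by have := not_al u ut; rewrite cuv c't ?eqxx //; apply/eqP.
  case: (eqVneq (c u) (Some al)) => cua; case: (eqVneq (c v) (Some al)) => cva.
  - by apply: cP; rewrite // cua.
  - exact: mixed.
  - have [|p ee] := mixed v u vt ut cva cua _ (esym cuv); first by rewrite -cuv.
    by rewrite eq_sym e_sym.
  - by apply: cP => //; rewrite -(c'else u) // -(c'else v).
(* [h] traces each vertex uncoloured in [c'] back to one uncoloured in [c]. It is injective there
   and misses [v0], so the number of uncoloured vertices drops. *)
pose h x := if c x == Some al then t (pt x) else x.
have unc x : ~~ c' x -> x != t (pt x) /\ ~~ c (h x).
  move=> cx; have xt : x != t (pt x) by apply: contra cx => /c't->.
  split=> //; move: cx; rewrite /h; case: (eqVneq (c x) (Some al)) => cxa.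
    by rewrite c'al.
  by rewrite c'else.
have hinj : {in [set v | ~~ c' v] &, injective h}.
  move=> x y; rewrite !inE => /unc[xt _] /unc[yt _]; rewrite /h.
  case: (eqVneq (c x) (Some al)) => cx; case: (eqVneq (c y) (Some al)) => cy //.
  - by move/(congr1 pt); rewrite !pt_t => pxy; apply: same cx cy.
  - by move=> txy; move: yt; rewrite -{1}txy -txy pt_t eqxx.
  - by move=> txy; move: xt; rewrite {1}txy txy pt_t eqxx.
rewrite -(card_in_imset hinj) [X in (_ < X)%N](cardsD1 v0) inE cv0 /= add1n ltnS.
apply: subset_leq_card; apply/subsetP => _ /imsetP[x xin ->]; rewrite inE in xin.
have [xt cx] := unc x xin; rewrite !inE cx andbT.
apply/eqP; rewrite /h; case: (eqVneq (c x) (Some al)) => cxa.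
  by move/(congr1 pt); rewrite pt_t => px; have := al_k0 x cxa; rewrite px eqxx.
by move=> xv; move: xt; rewrite xv /t eqxx eqxx.
Qed.

Theorem strong_colouring : exists c : V -> 'I_M,
  forall u v, u != v -> c u = c v -> pt u != pt v /\ ~~ e u v.
Proof.
pose c0 : {ffun V -> option 'I_M} := [ffun=> None].
have c0P : partial_colouring c0 by apply/partial_colouringP => u v _; rewrite ffunE.
case: (arg_minnP (fun c : {ffun V -> option 'I_M} => #|[set v | ~~ c v]|) c0P) => c cP cmin.
have ex v : exists a, c v = Some a.
  case E: (c v) => [a|]; first by exists a.
  have [c' c'P lt] := extend_partial_colouring cP E.
  by have := cmin c' c'P; rewrite leqNgt lt.
have [f fP] := fin_all_exists ex; exists f => u v uv fuv.
by apply: (partial_colouringP _ cP); rewrite ?fP // fuv.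
Qed.
End StrongColouring.

(** * From the strong colouring to the factor *)

Lemma colouring_factor (V : finType) (e : rel V) (r : nat) (P : 'I_r -> {set V})
    (n M : nat) (bin : V -> 'I_n.+1) (c : V -> 'I_M) : irreflexive e ->
    (forall i k, #|[set x in P i | bin x == k]| = M) ->
    (forall u v, u != v -> c u = c v -> ~~ e u v) ->
    (forall i u v, u \in P i -> v \in P i -> bin u = bin v -> c u = c v -> u = v) ->
  exists F : {set {set V}}, transversal_blowup_factor e P n.+1 F.
Proof.
move=> e_irr bins c_proper c_inj.
pose T a := [set x | c x == a].
exists [set T a | a in 'I_M]; split.
- move=> _ /imsetP[a _ ->]; split=> [u v|i].
    rewrite !inE => /eqP cu /eqP cv; case: (eqVneq u v) => [->|uv].
      by rewrite e_irr.
    by apply: c_proper; rewrite // cu cv.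
  rewrite -(sum_card_fibers _ bin) -[RHS]card_ord -sum1_card; apply: eq_bigr => k _.
  pose B := [set x in P i | bin x == k].
  have cB : {in B &, injective c}.
    by move=> x y; rewrite !inE => /andP[xi /eqP xk] /andP[yi /eqP yk];
      apply: c_inj xi yi _; rewrite xk yk.
  (* The [M] vertices of a bin have distinct colours out of [M], so each colour occurs exactly once
     in every bin. *)
  have : a \in c @: B.
    suff -> : c @: B = [set: 'I_M] by rewrite inE.
    by apply/eqP; rewrite eqEcard subsetT cardsT card_ord card_in_imset // bins leqnn.
  case/imsetP => x xB ax; apply/eqP/cards1P; exists x; apply/setP => y.
  rewrite !inE; apply/andP/eqP => [[/andP[/eqP cy yi] yk]|->].
    by apply: cB => //; rewrite ?inE ?yi // cy.
  by move: xB; rewrite inE -ax eqxx => /andP[-> ->].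
- apply/trivIsetP => _ _ /imsetP[a _ ->] /imsetP[b _ ->] ab.
  rewrite -setI_eq0; apply/eqP/setP => x; rewrite !inE.
  by apply/andP => -[/eqP xa /eqP xb]; move: ab; rewrite -xa -xb eqxx.
- apply/setP => x; rewrite inE; apply/bigcupP; exists (T (c x)); last by rewrite inE.
  exact: imset_f.
Qed.

Lemma local_degree_ge (V : finType) (e : rel V) (r : nat) (P : 'I_r -> {set V}) v i :
  (degree_in e v (P i) <= local_degree e P)%N.
Proof.
apply: leq_trans (leq_bigmax v); exact: (leq_bigmax (F := fun i => degree_in e v (P i))).
Qed.

Theorem blowup_factor (R : realType) (eps : R) (n : nat) : 0 < eps ->
  exists delta : R, 0 < delta /\ exists D0 : nat, forall D N : nat, (D0 <= D)%N ->
  N%:R = (2 + eps) * n.+1%:R ^+ 2 * D%:R -> (n.+1 %| N)%N ->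
  forall (V : finType) (e : rel V) (r : nat) (P : 'I_r -> {set V}),
    simple_graph e -> multipartite e P -> (forall i, #|P i| = N) ->
    (max_degree e <= D)%N -> (local_degree e P)%:R <= delta * D%:R ->
  exists F : {set {set V}}, transversal_blowup_factor e P n.+1 F.
Proof.
(* One half of [eps] pays for the local degree, the other half is the surplus of the transversals,
   capped at 1 as [locally_sparse_transversal] requires. *)
move=> eps0; pose e1 := Num.min 1 (eps / 2).
have e10 : 0 < e1 by rewrite lt_min ltr01 divr_gt0.
have e11 : e1 <= 1 by rewrite ge_min lexx.
have e1e : e1 <= eps / 2 by rewrite ge_min lexx orbT.
have [d1 [d10 [D0 tr]]] := locally_sparse_transversal e10 e11.
exists (Num.min d1 (eps / 2)); split; first by rewrite lt_min d10 divr_gt0.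
exists D0 => D N DD0 NE sN V e r P [e_sym e_irr] [covP disP indP] cardP degP locP.
set g := local_degree e P in locP.
have D0' : 0 <= D%:R :> R by [].
have gd1 : g%:R <= d1 * D%:R.
  by apply: le_trans locP _; rewrite ler_wpM2r // ge_min lexx.
have ge2 : g%:R <= eps / 2 * D%:R.
  by apply: le_trans locP _; rewrite ler_wpM2r // ge_min lexx orbT.
have ex v : exists i, v \in P i.
  by have : v \in \bigcup_(i < r) P i; [rewrite covP inE|case/bigcupP=> i _; exists i].
have [pt0 pt0P] := fin_all_exists ex.
have PE i x : (x \in P i) = (pt0 x == i).
  apply/idP/eqP => [xi|<-]; last exact: pt0P.
  apply/eqP; apply: contraT => /disP/disjointFr/(_ (pt0P x)); by rewrite xi.
pose M := (N %/ n.+1)%N.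
have NM : N = (n.+1 * M)%N by rewrite mulnC divnK.
have [i|S [bin [_ bins]]] := @equal_bins V _ pt0 setT n M.
  rewrite -NM -(cardP i) leq_eqVlt; apply/orP; left.
  by apply/eqP; apply: eq_card => x; rewrite !inE PE.
(* The bins have total size exactly [N] in each block, so no vertex is discarded. *)
have ST : S = setT.
  apply/setP => x; rewrite inE.
  suff /setP/(_ x) : [set y in S | pt0 y == pt0 x] = P (pt0 x).
    by rewrite inE PE eqxx andbT.
  apply/eqP; rewrite eqEcard cardP; apply/andP; split.
    by apply/subsetP => y; rewrite inE PE => /andP[].
  rewrite NM -(sum_card_fibers _ bin).
  have -> : (n.+1 * M = \sum_(k < n.+1) M)%N by rewrite sum_nat_const card_ord.
  apply: leq_sum => k _; rewrite -(bins (pt0 x) k); apply: subset_leq_card.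
  by apply/subsetP => y; rewrite !inE => /and3P[-> -> ->].
rewrite {S}ST in bins.
pose pt x := (pt0 x, bin x).
have e_blocks u v : e u v -> pt u != pt v.
  move=> euv; apply/eqP => -[puv _]; have := indP (pt0 u) u v.
  by rewrite !PE eqxx puv eqxx euv => /(_ isT isT).
have blocks i : #|[set x | pt x == i]| = M.
  by case: i => i k; rewrite -(bins i k); apply: eq_card => x; rewrite !inE xpair_eqE.
have degree v : (#|[set u | e v u]| <= D)%N.
  apply: leq_trans degP; apply: leq_trans (leq_bigmax v).
  by apply: subset_leq_card; apply/subsetP => u; rewrite !inE.
have local v i : (#|[set u | e v u & pt u == i]| <= g)%N.
  apply: leq_trans (local_degree_ge e P v i.1); apply: subset_leq_card.
  by apply/subsetP => u; rewrite !inE PE => /andP[-> /eqP<-]; rewrite eqxx.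
have ME : M%:R = (2 + eps) * n.+1%:R * D%:R.
  have n0 : n.+1%:R != 0 :> R by rewrite pnatr_eq0.
  by apply: (mulfI n0); rewrite -natrM -NM NE; ring.
have M2 : (2 + eps) * D%:R <= M%:R.
  by rewrite ME ler_wpM2r // ler_peMr ?ler1n // addr_ge0 // ltW.
have MDg : (D + g <= M)%N.
  by rewrite -(ler_nat R) natrD; nra.
(* A part has at least [(2 + eps) * D] vertices, of which an extension of the colouring forbids at
   most [D + g]. *)
have big : (1 + e1) * D%:R <= (M - (D + g))%N%:R.
  rewrite natrB // natrD.
  have : e1 * D%:R <= eps / 2 * D%:R by rewrite ler_wpM2r.
  by clear - M2 ge2; lra.
have [|c cP] := @strong_colouring V _ pt e M D g e_sym blocks degree local.
  move=> A bigA; apply: (tr D g DD0 gd1) => //.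
  - by move=> i; apply: le_trans big _; rewrite ler_nat.
  - move=> v; apply: leq_trans (degree v); apply: subset_leq_card.
    by apply/subsetP => u; rewrite !inE => /andP[].
  - move=> v i; apply: leq_trans (local v i); apply: subset_leq_card.
    by apply/subsetP => u; rewrite !inE => /andP[].
apply: (colouring_factor (bin := bin) (c := c)) => //.
- by move=> i k; rewrite -(bins i k); apply: eq_card => x; rewrite !inE PE.
- by move=> u v uv cuv; have [] := cP u v uv cuv.
- move=> i u v; rewrite !PE => /eqP ui /eqP vi buv cuv; apply/eqP; apply: contraT => uv.
  by have [] := cP u v uv cuv; rewrite /pt ui vi buv eqxx.
Qed.

(* Local degree of smaller order than the maximum degree *)
From mathcomp Require Import boolp classical_sets reals topology normedtype sequences.
Import numFieldNormedType.Exports.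
Local Open Scope classical_set_scope.
Local Open Scope ring_scope.

Theorem theorem5p6 (R : realType) (s : nat) (eps : R) (g : nat -> R)
    (s_ge1 : (1 <= s)%N) (eps_gt0 : 0 < eps)
    (g_ge0 : forall n : nat, 0 <= g n)
    (g_small : g n / n%:R @[n --> \oo] --> (0 : R)) :
  exists Delta0 : nat, forall Delta : nat, (Delta0 <= Delta)%N ->
  forall N : nat, N%:R = (2 + eps) * s%:R ^+ 2 * Delta%:R -> (s %| N)%N ->
  forall (V : finType) (e : rel V) (r : nat) (P : 'I_r -> {set V}),
    simple_graph e -> multipartite e P ->
    (forall i : 'I_r, #|P i| = N) ->
    (max_degree e <= Delta)%N ->
    (local_degree e P)%:R <= g Delta ->
  exists F : {set {set V}}, transversal_blowup_factor e P s F.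
Proof.
case: s s_ge1 => // n _.
have [delta [delta0 [D0 factor]]] := blowup_factor n eps_gt0.
have /cvgr0Pnorm_lt/(_ _ delta0)[N0 _ small] := g_small.
(* The 1 makes [Delta] positive, so that the bound on [g Delta / Delta] can be multiplied out. *)
exists (maxn D0 (maxn N0 1)) => Delta.
rewrite !geq_max => /and3P[D0le N0le Delta_gt0] N NE sN V e r P eP mP cP dP lP.
apply: (factor Delta N) => //; apply: le_trans lP _.
have Delta_gt0' : 0 < Delta%:R :> R by rewrite ltr0n.
rewrite -ler_pdivrMr //; apply: le_trans (ler_norm _) (ltW _).
exact: small.
Qed.
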